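(* Fix a $2\times 2$ unitary matrix $C_0=\begin{bmatrix} a & b\\ c & d\end{bmatrix}$ with $abcd\neq 0$. For an integer $M\ge 1$ and a frequency $\xi\in\mathbb{R}$, consider the quantum walk on $\mathbb{Z}$ with inflow described in the context, with stationary comfortability distribution $\mu_M$ on $\{0,1,\dots,M-1\}$, and let $X_M$ be a random variable with law $\mu_M$. Put $\omega=\arg(\det C_0)/2+\xi$ (the frequency $\xi$, hence $\omega$, may depend on $M$). Then, as $M\to\infty$, $X_M/M$ converges in distribution to the probability law on $\mathbb{R}$ with density $\rho^{(\omega)}(x)=\mathbf{1}_{[0,1]}(x)\,g(x)$, where: (i) if $\omega\in B_{out}$, then $g(x)=\delta(x)$, i.e. the limit law is the point mass at $0$; (ii) if $\omega\in\partial B$, or if $\omega\in B_{in}$ and $M\theta\to 0$, then $g(x)=3(1-x)^2$; (iii) if $\omega\in B_{in}$ and $M\theta\to\theta_*$ with $0<\theta_*<\infty$, then $g(x)=c(\theta_* )\sin^2[(1-x)\theta_*]$ with $c(\theta_* )=2\left(1-\frac{\sin 2\theta_*}{2\theta_*}\right)^{-1}$; (iv) if $\omega\in B_{in}$ and $M\theta\to\infty$, then $g(x)=1$ (uniform law on $[0,1]$).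
   Context: Notation: $|L\rangle=[1,0]^\top$, $|R\rangle=[0,1]^\top$. For $j\in\mathbb{Z}$ set $C(j)=C_0$ if $j\in\{0,\dots,M-1\}$ and $C(j)=I$ (identity) otherwise, and $P(j)=|L\rangle\langle L|C(j)$, $Q(j)=|R\rangle\langle R|C(j)$. The operator $U_M$ acts on uniformly bounded functions $\psi:\mathbb{Z}\to\mathbb{C}^2$ by $(U_M\psi)(j)=P(j+1)\psi(j+1)+Q(j-1)\psi(j-1)$. The initial state is $\psi_0(j)=e^{i\xi j}|R\rangle$ for $j\le 0$ and $\psi_0(j)=0$ for $j>0$, and $\psi_t=U_M^t\psi_0$. The state $e^{i\xi t}\psi_t$ converges pointwise to a stationary state as $t\to\infty$, and the distribution of the comfortability is $\mu_M(j)=\lim_{t\to\infty}\frac{\|\psi_t(j)\|^2}{\sum_{k=0}^{M-1}\|\psi_t(k)\|^2}$ for $j\in\{0,\dots,M-1\}$. The parameter regions are $B_{out}=\{\omega: |\cos\omega|>|a|\}$, $\partial B=\{\omega:|\cos\omega|=|a|\}$, $B_{in}=\{\omega:|\cos\omega|<|a|\}$. For $\omega\in B_{in}$, $\theta=\arccos\frac{\cos\omega}{|a|}$ if $\frac{\cos\omega}{|a|}>0$ and $\theta=\pi-\arccos\frac{\cos\omega}{|a|}$ otherwise (so $\theta>0$); in cases (ii)–(iv) with $\omega\in B_{in}$, $\omega$ and $\theta$ depend on $M$. In cases (i) and (ii) with $\omega\in\partial B$, $\omega$ is fixed. *)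

(* Defs.v *)
From Stdlib Require Import Reals ZArith List.
From Coquelicot Require Import Coquelicot.
Open Scope R_scope.

(* Principal argument of a complex number, in (-pi, pi] (arbitrary value 0 at z = 0). *)
Definition Carg (z : C) : R :=
  if Req_EM_T (Cmod z) 0 then 0
  else if Rle_dec 0 (Im z) then acos (Re z / Cmod z)
       else - acos (Re z / Cmod z).

(* C0 = [[a, b], [c, d]] is unitary: C0^* C0 = I (written out entrywise). *)
Definition unitary2 (a b c d : C) : Prop :=
  (Cconj a * a + Cconj c * c = 1)%C /\
  (Cconj a * b + Cconj c * d = 0)%C /\
  (Cconj b * a + Cconj d * c = 0)%C /\
  (Cconj b * b + Cconj d * d = 1)%C.

Definition det2 (a b c d : C) : C := (a * d - b * c)%C.

Definition inM (M : nat) (j : Z) : bool := (0 <=? j)%Z && (j <? Z.of_nat M)%Z.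

(* The two components of C(j) v, where C(j) = C0 on {0..M-1} and I elsewhere;
   P(j) v = (rowL j v, 0) and Q(j) v = (0, rowR j v). *)
Definition rowL (a b c d : C) (M : nat) (j : Z) (v : C * C) : C :=
  if inM M j then (a * fst v + b * snd v)%C else fst v.
Definition rowR (a b c d : C) (M : nat) (j : Z) (v : C * C) : C :=
  if inM M j then (c * fst v + d * snd v)%C else snd v.

Definition UM (a b c d : C) (M : nat) (psi : Z -> C * C) : Z -> C * C :=
  fun j => (rowL a b c d M (j + 1)%Z (psi (j + 1)%Z),
            rowR a b c d M (j - 1)%Z (psi (j - 1)%Z)).

(* psi_0(j) = e^{i xi j} |R> for j <= 0, 0 for j > 0; |L> = (1,0), |R> = (0,1). *)
Definition psi0 (xi : R) (j : Z) : C * C :=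
  if (j <=? 0)%Z then (RtoC 0, (cos (xi * IZR j), sin (xi * IZR j)) : C)
  else (RtoC 0, RtoC 0).

Fixpoint psi (a b c d : C) (M : nat) (xi : R) (t : nat) : Z -> C * C :=
  match t with
  | O => psi0 xi
  | S t' => UM a b c d M (psi a b c d M xi t')
  end.

Definition normsq (v : C * C) : R := (Cmod (fst v))^2 + (Cmod (snd v))^2.

Definition sumM (M : nat) (f : nat -> R) : R := fold_right Rplus 0 (map f (seq 0 M)).

Definition mu (a b c d : C) (M : nat) (xi : R) (j : nat) : R :=
  real (Lim_seq (fun t =>
    normsq (psi a b c d M xi t (Z.of_nat j)) /
    sumM M (fun k => normsq (psi a b c d M xi t (Z.of_nat k))))).

(* The law of X_M / M (X_M ~ mu_M, with xi = xi_M) converges in distribution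
   to the law whose expectation functional is L: for every bounded continuous f,
   E f(X_M/M) -> L f. *)
Definition conv_in_dist (a b c d : C) (xi : nat -> R) (L : (R -> R) -> R) : Prop :=
  forall f : R -> R,
    (forall x, continuous f x) ->
    (exists B, forall x, Rabs (f x) <= B) ->
    is_lim_seq (fun M => sumM M (fun j => mu a b c d M (xi M) j * f (INR j / INR M))) (L f).

Definition dens_law (g : R -> R) (f : R -> R) : R := RInt (fun x => g x * f x) 0 1.

Definition dirac0 (f : R -> R) : R := f 0.

Definition omega (a b c d : C) (xi : R) : R := Carg (det2 a b c d) / 2 + xi.

Definition B_out (a : C) (w : R) : Prop := Rabs (cos w) > Cmod a.
Definition B_bd (a : C) (w : R) : Prop := Rabs (cos w) = Cmod a.
Definition B_in (a : C) (w : R) : Prop := Rabs (cos w) < Cmod a.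

Definition theta (a : C) (w : R) : R :=
  if Rlt_dec 0 (cos w / Cmod a) then acos (cos w / Cmod a)
  else PI - acos (cos w / Cmod a).

Definition c_theta (ts : R) : R := 2 * / (1 - sin (2 * ts) / (2 * ts)).

(* Main.v *)
Require Import Defs.
From Stdlib Require Import Reals ZArith List.
From Coquelicot Require Import Coquelicot.
From Stdlib Require Import Lra Lia.
Open Scope R_scope.

(* The stationary state phi solves a linear recurrence in space. Solved leftwards from the site
   M - 1, where its left component vanishes, with tau = cos(omega)/|a| and the Chebyshev
   polynomials U_n, it gives, up to a common factor,
     ||phi(M - 1 - n)||^2 = |a|^2 + |b|^2 (U_{n-1}(tau)^2 + U_n(tau)^2).
   Convergence of e^{i xi t} psi_t to phi needs no spectral theory: the difference evolves
   isometrically except for the energy leaking out of the interval, so the leak tends to 0,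
   and this forces each component of the difference to 0 in turn.
   For |tau| <= 1 the partial sums of the weights are explicit, for instance
     sum_{k<n} (sin^2(k theta) + sin^2((k+1) theta))
       = n - cos(theta) sin(2 n theta) / (2 sin(theta)),
   so the distribution functions converge uniformly, and summation by parts against Lipschitz
   test functions concludes. For |tau| > 1 the weights grow geometrically in n, so X_M has
   bounded mean. *)

(** * Finite sums *)

Lemma sumM_S (n : nat) (f : nat -> R) : sumM (S n) f = sumM n f + f n.
Proof.
  unfold sumM. rewrite seq_S, map_app, fold_right_app. cbn.
  rewrite Rplus_0_r. generalize (map f (seq 0 n)).
  induction l as [|x l IH]; cbn; [ring | rewrite IH; ring].
Qed.

Lemma sumM_Sl (n : nat) (f : nat -> R) : sumM (S n) f = f 0%nat + sumM n (fun k => f (S k)).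
Proof.
  induction n as [|n IH]; [cbn; ring|].
  rewrite sumM_S, IH, sumM_S. ring.
Qed.

Lemma sumM_ext (n : nat) (f g : nat -> R) :
  (forall k, (k < n)%nat -> f k = g k) -> sumM n f = sumM n g.
Proof.
  induction n as [|n IH]; intros H; [reflexivity|].
  rewrite !sumM_S, IH, H; auto.
Qed.

Lemma sumM_plus (n : nat) (f g : nat -> R) :
  sumM n (fun k => f k + g k) = sumM n f + sumM n g.
Proof. induction n as [|n IH]; [cbn; ring | rewrite !sumM_S, IH; ring]. Qed.

Lemma sumM_scal (n : nat) (x : R) (f : nat -> R) :
  sumM n (fun k => x * f k) = x * sumM n f.
Proof. induction n as [|n IH]; [cbn; ring | rewrite !sumM_S, IH; ring]. Qed.

Lemma sumM_le (n : nat) (f g : nat -> R) :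
  (forall k, (k < n)%nat -> f k <= g k) -> sumM n f <= sumM n g.
Proof.
  induction n as [|n IH]; intros H; [apply Rle_refl|].
  rewrite !sumM_S. apply Rplus_le_compat; auto.
Qed.

Lemma sumM_nonneg (n : nat) (f : nat -> R) :
  (forall k, (k < n)%nat -> 0 <= f k) -> 0 <= sumM n f.
Proof.
  induction n as [|n IH]; intros H; [apply Rle_refl|].
  rewrite sumM_S. apply Rplus_le_le_0_compat; auto.
Qed.

Lemma sumM_rev (n : nat) (f : nat -> R) : sumM n (fun k => f (n - 1 - k)%nat) = sumM n f.
Proof.
  induction n as [|n IH]; [reflexivity|].
  rewrite sumM_Sl, sumM_S, <- IH, Rplus_comm. f_equal.
  - apply sumM_ext. intros k Hk. f_equal. lia.
  - f_equal. lia.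
Qed.

Lemma is_lim_seq_sumM (n : nat) (u : nat -> nat -> R) (l : nat -> R) :
  (forall k, (k < n)%nat -> is_lim_seq (fun t => u t k) (l k)) ->
  is_lim_seq (fun t => sumM n (u t)) (sumM n l).
Proof.
  induction n as [|n IH]; intros H.
  - apply is_lim_seq_const.
  - rewrite sumM_S. apply is_lim_seq_ext with (fun t => sumM n (u t) + u t n).
    { intros t; now rewrite sumM_S. }
    apply is_lim_seq_plus'; auto.
Qed.

(** * Complex phases and unitary coins *)

Definition cis (x : R) : C := (cos x, sin x).

Lemma cis_plus (x y : R) : cis (x + y) = (cis x * cis y)%C.
Proof. unfold cis, Cmult; cbn. rewrite cos_plus, sin_plus. f_equal; ring. Qed.

Lemma cis_0 : cis 0 = 1%C.
Proof. unfold cis. now rewrite cos_0, sin_0. Qed.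

Lemma Cmod_cis (x : R) : Cmod (cis x) = 1.
Proof.
  unfold Cmod, cis; cbn [fst snd]. rewrite <- !Rsqr_pow2, Rplus_comm, sin2_cos2. apply sqrt_1.
Qed.

Lemma cis_neq0 (x : R) : cis x <> 0%C.
Proof. apply Cmod_gt_0. rewrite Cmod_cis. lra. Qed.

Lemma cis_opp (x : R) : (cis (- x) * cis x)%C = 1%C.
Proof. rewrite <- cis_plus. replace (- x + x) with 0 by ring. apply cis_0. Qed.

Lemma Cmod_sqr (z : C) : Cmod z ^ 2 = fst z ^ 2 + snd z ^ 2.
Proof. unfold Cmod. apply pow2_sqrt. nra. Qed.

Lemma Cmult_conj_l (z : C) : (Cconj z * z)%C = RtoC (Cmod z ^ 2).
Proof.
  rewrite Cmod_sqr. destruct z as [x y]. unfold Cconj, Cmult, RtoC; cbn. f_equal; ring.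
Qed.

(** The sign test in [Carg] selects the half circle: sin(acos x) = sqrt(1 - x^2) = |y|, so a
    negative imaginary part requires the opposite angle. *)
Lemma cis_Carg (z : C) : Cmod z = 1 -> z = cis (Carg z).
Proof.
  intros H. assert (H2 := Cmod_sqr z). rewrite H in H2.
  destruct z as [x y]. unfold Carg. rewrite H.
  destruct (Req_EM_T 1 0) as [?|_]; [lra|].
  unfold Re, Im; cbn [fst snd] in *. rewrite Rdiv_1_r.
  assert (Hx : -1 <= x <= 1) by nra.
  assert (E : 1 - x² = y²) by (unfold Rsqr; lra).
  unfold cis. destruct (Rle_dec 0 y) as [Hy|Hy].
  - rewrite cos_acos, sin_acos, E, sqrt_Rsqr; auto.
  - rewrite cos_neg, sin_neg, cos_acos, sin_acos, E, sqrt_Rsqr_abs, Rabs_left by lra.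
    f_equal; ring.
Qed.

Section Coin.

Variables a b c d : C.
Hypothesis HU : unitary2 a b c d.
Hypothesis Ha : a <> 0%C.
Hypothesis Hd : d <> 0%C.

Let D := det2 a b c d.

(** Multiplying the norm of the first column by d and subtracting c times the inner product of the
    columns leaves conj(a) (ad - bc). This is the adjugate formula for the inverse, read off
    entrywise. *)
Lemma unitary_d : d = (D * Cconj a)%C.
Proof.
  destruct HU as (H1 & H2 & H3 & H4). unfold D, det2.
  transitivity (d * (Cconj a * a + Cconj c * c) - c * (Cconj a * b + Cconj c * d))%C; [|ring].
  rewrite H1, H2. ring.
Qed.

Lemma unitary_c : c = (- (D * Cconj b))%C.
Proof.
  destruct HU as (H1 & H2 & H3 & H4). unfold D, det2.
  transitivity (c * (Cconj b * b + Cconj d * d) - d * (Cconj b * a + Cconj d * c))%C; [|ring].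
  rewrite H3, H4. ring.
Qed.

(** The hypothesis normalises the columns. Inserting the formulas for d and c into D = ad - bc gives
    D = D (|a|^2 + |b|^2), and D is nonzero because d is. *)
Lemma unitary_row : Cmod a ^ 2 + Cmod b ^ 2 = 1.
Proof.
  assert (HD : D <> 0%C).
  { intros E. apply Hd. rewrite unitary_d, E. ring. }
  assert (E : (D * RtoC (Cmod a ^ 2 + Cmod b ^ 2) = D * 1)%C).
  { rewrite RtoC_plus, <- !Cmult_conj_l.
    transitivity (a * (D * Cconj a) - b * (- (D * Cconj b)))%C; [ring|].
    rewrite <- unitary_d, <- unitary_c. unfold D, det2. ring. }
  assert (E2 : RtoC (Cmod a ^ 2 + Cmod b ^ 2) = 1%C).
  { transitivity (/ D * (D * RtoC (Cmod a ^ 2 + Cmod b ^ 2)))%C.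
    - field; auto.
    - rewrite E. field; auto. }
  now apply RtoC_inj in E2.
Qed.

Lemma Cmod_det : Cmod D = 1.
Proof.
  assert (E := unitary_row). destruct HU as (_ & _ & _ & H4).
  rewrite !Cmult_conj_l, <- RtoC_plus in H4. apply RtoC_inj in H4.
  assert (E1 : Cmod d = Cmod D * Cmod a).
  { rewrite unitary_d at 1. now rewrite Cmod_mult, Cmod_conj. }
  assert (E2 := Cmod_ge_0 D). apply Cmod_gt_0 in Ha.
  rewrite E1 in H4.
  assert (Cmod a ^ 2 * (Cmod D ^ 2 - 1) = 0) by nra.
  assert (Cmod D ^ 2 - 1 = 0) by (apply Rmult_integral in H; nra).
  nra.
Qed.

(** Expanding the squares produces the four entries of the unitarity relation. The identity serves
    twice: for the energy balance in time and for the conserved current in space. *)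
Lemma unitary_isometry (L R : C) :
  Cmod (a * L + b * R) ^ 2 + Cmod (c * L + d * R) ^ 2 = Cmod L ^ 2 + Cmod R ^ 2.
Proof.
  apply RtoC_inj. rewrite !RtoC_plus, <- !Cmult_conj_l.
  rewrite !Cplus_conj, !Cmult_conj.
  destruct HU as (H1 & H2 & H3 & H4).
  transitivity (Cconj L * L * (Cconj a * a + Cconj c * c)
    + Cconj L * R * (Cconj a * b + Cconj c * d)
    + Cconj R * L * (Cconj b * a + Cconj d * c)
    + Cconj R * R * (Cconj b * b + Cconj d * d))%C; [ring|].
  rewrite H1, H2, H3, H4. ring.
Qed.

End Coin.

(** * Convergence to the stationary state *)

Definition null (u : nat -> C) : Prop := is_lim_seq (fun t => Cmod (u t)) 0.

Lemma null_squeeze (u : nat -> C) (v : nat -> R) :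
  (forall t, Cmod (u t) <= v t) -> is_lim_seq v 0 -> null u.
Proof.
  intros H Hv. apply is_lim_seq_le_le with (fun _ => 0) v; auto.
  - intros t. split; auto. apply Cmod_ge_0.
  - apply is_lim_seq_const.
Qed.

Lemma null_ext (u v : nat -> C) : (forall t, u t = v t) -> null u -> null v.
Proof. intros H. apply is_lim_seq_ext. intros t. now rewrite H. Qed.

Lemma null_plus (u v : nat -> C) : null u -> null v -> null (fun t => u t + v t)%C.
Proof.
  intros Hu Hv. apply null_squeeze with (fun t => Cmod (u t) + Cmod (v t)).
  - intros t. apply Cmod_triangle.
  - replace 0 with (0 + 0) by ring. apply is_lim_seq_plus'; assumption.
Qed.

Lemma null_scal (k : C) (u : nat -> C) : null u -> null (fun t => k * u t)%C.
Proof.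
  intros Hu. apply is_lim_seq_ext with (fun t => Cmod k * Cmod (u t)).
  { intros t. now rewrite Cmod_mult. }
  replace (Finite 0) with (Rbar_mult (Cmod k) 0) by (cbn; f_equal; ring).
  now apply is_lim_seq_scal_l.
Qed.

Lemma null_incr_1 (u : nat -> C) : null u <-> null (fun t => u (S t)).
Proof. unfold null. apply (is_lim_seq_incr_1 (fun t => Cmod (u t))). Qed.

(** Two sequences appear because psi_t carries a rotating phase: [u] = e^{i xi t} psi_t converges,
    and [v] = psi_t has the same moduli. *)
Lemma null_Cmod_limit (u v : nat -> C) (l : C) :
  (forall t, Cmod (v t) = Cmod (u t)) ->
  null (fun t => u t - l)%C -> is_lim_seq (fun t => Cmod (v t)) (Cmod l).
Proof.
  intros Hv H. apply is_lim_seq_ext with (fun t => (Cmod (u t) - Cmod l) + Cmod l).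
  { intros t. rewrite Hv. ring. }
  replace (Finite (Cmod l)) with (Finite (0 + Cmod l)) by (f_equal; ring).
  apply is_lim_seq_plus'; [|apply is_lim_seq_const].
  apply is_lim_seq_abs_0.
  apply is_lim_seq_le_le with (fun _ => 0) (fun t => Cmod (u t - l)); auto.
  - intros t. split; [apply Rabs_pos|].
    apply Rabs_le. split.
    + assert (E := Cmod_triangle (u t) (- (u t - l))).
      rewrite Cmod_opp in E. replace (u t + - (u t - l))%C with l in E by ring. lra.
    + assert (E := Cmod_triangle (u t - l) l).
      replace (u t - l + l)%C with (u t) in E by ring. lra.
  - apply is_lim_seq_const.
Qed.

Lemma decreasing_gap_limit (e : nat -> R) :
  (forall t, 0 <= e t) -> (forall t, e (S t) <= e t) ->
  is_lim_seq (fun t => e t - e (S t)) 0.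
Proof.
  intros H0 H1. destruct (ex_finite_lim_seq_decr e 0 H1 H0) as [l Hl].
  replace (Finite 0) with (Finite (l - l)) by (f_equal; ring).
  apply is_lim_seq_minus'; auto. now apply is_lim_seq_incr_1 in Hl.
Qed.

(* Each step loses the energy leaving the interval on either side; since the total loss is
   finite, the left component at site 0 vanishes in the limit, and the recurrences propagate
   this to the other sites one by one. *)
Lemma homogeneous_walk_vanishes (a b c d z : C) (m : nat) (L R : nat -> nat -> C) :
  unitary2 a b c d -> a <> 0%C -> Cmod z = 1 ->
  (forall t, R t 0%nat = 0%C) -> (forall t, L t m = 0%C) ->
  (forall t j, (j < m)%nat -> L (S t) j = (z * (a * L t (S j) + b * R t (S j)))%C) ->
  (forall t j, (j < m)%nat -> R (S t) (S j) = (z * (c * L t j + d * R t j))%C) ->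
  forall j, (j <= m)%nat -> null (fun t => L t j) /\ null (fun t => R t j).
Proof.
  intros HU Ha Hz HR0 HLm HL HR.
  set (A := fun t j => Cmod (a * L t j + b * R t j) ^ 2).
  set (B := fun t j => Cmod (c * L t j + d * R t j) ^ 2).
  set (e := fun t => sumM (S m) (fun j => Cmod (L t j) ^ 2 + Cmod (R t j) ^ 2)).
  (* Energy balance: the coin preserves the norm at each site and the shift moves its outputs, so a
     step loses exactly what leaves to the left of site 0 and to the right of site [m]. *)
  assert (He : forall t, e t = e (S t) + (A t 0%nat + B t m)).
  { intros t. unfold e.
    rewrite (sumM_ext (S m) _ (fun j => A t j + B t j))
      by (intros j _; symmetry; apply unitary_isometry; assumption).
    rewrite !sumM_plus.
    rewrite (sumM_Sl m (A t)), (sumM_S m (B t)).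
    rewrite (sumM_S m (fun j => Cmod (L (S t) j) ^ 2)).
    rewrite (sumM_Sl m (fun j => Cmod (R (S t) j) ^ 2)).
    rewrite HR0, HLm, Cmod_0.
    rewrite (sumM_ext m (fun j => Cmod (L (S t) j) ^ 2) (fun j => A t (S j))).
    2:{ intros j Hj. rewrite HL by assumption. unfold A. now rewrite Cmod_mult, Hz, Rmult_1_l. }
    rewrite (sumM_ext m (fun j => Cmod (R (S t) (S j)) ^ 2) (fun j => B t j)).
    2:{ intros j Hj. rewrite HR by assumption. unfold B. now rewrite Cmod_mult, Hz, Rmult_1_l. }
    change (fun j => B t j) with (B t). ring. }
  assert (HA : forall t, 0 <= A t 0%nat) by (intros; apply pow2_ge_0).
  assert (HB : forall t, 0 <= B t m) by (intros; apply pow2_ge_0).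
  assert (Hgap : is_lim_seq (fun t => e t - e (S t)) 0).
  { apply decreasing_gap_limit.
    - intros t. apply sumM_nonneg. intros k _. assert (E1 := pow2_ge_0 (Cmod (L t k))).
      assert (E2 := pow2_ge_0 (Cmod (R t k))). lra.
    - intros t. rewrite (He t). specialize (HA t). specialize (HB t). lra. }
  assert (Hz0 : z <> 0%C) by (apply Cmod_gt_0; rewrite Hz; lra).
  (* As [R] vanishes at site 0, the leak there is |a L|^2, which is at most the energy lost in the
     step. *)
  assert (H0 : null (fun t => L t 0%nat)).
  { apply null_ext with (fun t => / a * (a * L t 0%nat))%C; [intros t; field; auto|].
    apply null_scal. apply null_squeeze with (fun t => sqrt (e t - e (S t))).
    - intros t. rewrite <- (sqrt_pow2 (Cmod _)) by apply Cmod_ge_0.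
      apply sqrt_le_1_alt. specialize (HB t). rewrite (He t).
      unfold A. rewrite HR0. replace (a * L t 0%nat + b * 0)%C with (a * L t 0%nat)%C by ring. lra.
    - rewrite <- sqrt_0. apply (is_lim_seq_continuous sqrt); auto.
      apply continuity_pt_sqrt. lra. }
  induction j as [|j IH]; intros Hj.
  - split; auto. apply null_ext with (fun _ => 0%C); [intros; now rewrite HR0|].
    unfold null. rewrite Cmod_0. apply is_lim_seq_const.
  - destruct (IH ltac:(lia)) as [IHL IHR].
    assert (HRj : null (fun t => R t (S j))).
    { apply null_incr_1. apply null_ext with (fun t => z * (c * L t j + d * R t j))%C.
      - intros t. now rewrite HR by lia.
      - apply null_scal, null_plus; now apply null_scal. }
    split; auto.
    (* The recurrence for [L] at site [j], solved for [L t (S j)]. *)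
    apply null_ext with (fun t => (/ (a * z)) * L (S t) j + (- (b / a)) * R t (S j))%C.
    { intros t. rewrite HL by lia. field. auto. }
    apply null_plus; apply null_scal; auto. now apply null_incr_1 in IHL.
Qed.

(** Left of the interval the right component is simply transported. Site 0 is included: it is fed
    from site -1, where the coin is still the identity. *)
Lemma psi_inflow (a b c d : C) (M : nat) (xi : R) (t : nat) (j : Z) :
  (j <= 0)%Z -> snd (psi a b c d M xi t j) = cis (xi * (IZR j - INR t)).
Proof.
  revert j. induction t as [|t IH]; intros j Hj.
  - cbn. unfold psi0. destruct (Z.leb_spec j 0); [|lia]. cbn. unfold cis.
    now rewrite Rminus_0_r.
  - cbn [psi UM snd]. unfold UM; cbn [snd]. unfold rowR, inM.
    destruct (Z.leb_spec 0 (j - 1)); [lia|]. cbn [andb].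
    rewrite IH by lia. f_equal. rewrite S_INR, minus_IZR. ring.
Qed.

(** Nothing moves left initially, and beyond the interval the identity coin creates no left
    component. Site M - 1 is included, being fed from site M. *)
Lemma psi_no_backflow (a b c d : C) (M : nat) (xi : R) (t : nat) (j : Z) :
  (Z.of_nat M <= j + 1)%Z -> fst (psi a b c d M xi t j) = 0%C.
Proof.
  revert j. induction t as [|t IH]; intros j Hj.
  - cbn. unfold psi0. destruct (Z.leb_spec j 0); reflexivity.
  - cbn [psi]. unfold UM; cbn [fst]. unfold rowL, inM.
    destruct (Z.ltb_spec (j + 1) (Z.of_nat M)); [lia|]. rewrite Bool.andb_false_r.
    apply IH. lia.
Qed.

Lemma psi_step_L (a b c d : C) (M : nat) (xi : R) (t j : nat) :
  (S j < M)%nat ->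
  fst (psi a b c d M xi (S t) (Z.of_nat j)) =
  (a * fst (psi a b c d M xi t (Z.of_nat (S j))) + b * snd (psi a b c d M xi t (Z.of_nat (S j))))%C.
Proof.
  intros Hj. cbn [psi]. unfold UM; cbn [fst]. unfold rowL, inM.
  replace (Z.of_nat j + 1)%Z with (Z.of_nat (S j)) by lia.
  destruct (Z.leb_spec 0 (Z.of_nat (S j))); [|lia].
  destruct (Z.ltb_spec (Z.of_nat (S j)) (Z.of_nat M)); [|lia]. reflexivity.
Qed.

Lemma psi_step_R (a b c d : C) (M : nat) (xi : R) (t j : nat) :
  (j < M)%nat ->
  snd (psi a b c d M xi (S t) (Z.of_nat (S j))) =
  (c * fst (psi a b c d M xi t (Z.of_nat j)) + d * snd (psi a b c d M xi t (Z.of_nat j)))%C.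
Proof.
  intros Hj. cbn [psi]. unfold UM; cbn [snd]. unfold rowR, inM.
  replace (Z.of_nat (S j) - 1)%Z with (Z.of_nat j) by lia.
  destruct (Z.leb_spec 0 (Z.of_nat j)); [|lia].
  destruct (Z.ltb_spec (Z.of_nat j) (Z.of_nat M)); [|lia]. reflexivity.
Qed.

(** * The stationary state *)

(* [chi n] is, up to a scalar, the stationary state at distance n from the right end M - 1:
   there the left component is 0, and the stationary equations are solved leftwards. *)
Fixpoint chi (a b c d z : C) (n : nat) : C * C :=
  match n with
  | O => (RtoC 0, RtoC 1)
  | S n' =>
    let v := chi a b c d z n' in
    let L := (z * (a * fst v + b * snd v))%C in
    (L, (snd v / z - c * L) / d)%C
  end.

Lemma chi_step_L (a b c d z : C) (n : nat) :
  fst (chi a b c d z (S n)) = (z * (a * fst (chi a b c d z n) + b * snd (chi a b c d z n)))%C.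
Proof. reflexivity. Qed.

Lemma chi_step_R (a b c d z : C) (n : nat) :
  z <> 0%C -> d <> 0%C ->
  snd (chi a b c d z n) =
  (z * (c * fst (chi a b c d z (S n)) + d * snd (chi a b c d z (S n))))%C.
Proof. intros Hz Hd. cbn [chi fst snd]. field. auto. Qed.

(* [w n] is the weight of the site at distance n from the right end. *)
Definition stat_mu (w : nat -> R) (M j : nat) : R := w (M - 1 - j)%nat / sumM M w.

(** The factor [k] makes the right component at site 0 equal to 1, the inflow with its phase
    removed. Then e^{i xi t} psi_t - k chi obeys the walk without inflow from either side, hence
    tends to 0, and |k|^2 cancels from the quotient. *)
Lemma mu_chi (a b c d : C) (M : nat) (xi : R) (j : nat) :
  unitary2 a b c d -> a <> 0%C -> d <> 0%C -> (j < M)%nat ->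
  snd (chi a b c d (cis xi) (M - 1)) <> 0%C ->
  mu a b c d M xi j = stat_mu (fun n => normsq (chi a b c d (cis xi) n)) M j.
Proof.
  intros HU Ha Hd Hj Hnz. set (z := cis xi) in *.
  assert (Hz0 : z <> 0%C) by apply cis_neq0.
  set (k := (/ snd (chi a b c d z (M - 1)))%C).
  set (p := fun t j => psi a b c d M xi t (Z.of_nat j)).
  set (x := fun j => chi a b c d z (M - 1 - j)).
  assert (Hv : forall i, (i <= M - 1)%nat ->
    null (fun t => cis (xi * INR t) * fst (p t i) - k * fst (x i))%C /\
    null (fun t => cis (xi * INR t) * snd (p t i) - k * snd (x i))%C).
  { assert (HS : forall t, cis (xi * INR (S t)) = (z * cis (xi * INR t))%C).
    { intros t. unfold z. rewrite <- cis_plus. f_equal. rewrite S_INR. ring. }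
    apply (homogeneous_walk_vanishes a b c d z (M - 1)
      (fun t i => cis (xi * INR t) * fst (p t i) - k * fst (x i))%C
      (fun t i => cis (xi * INR t) * snd (p t i) - k * snd (x i))%C HU Ha (Cmod_cis xi)).
    - intros t. unfold p, x. rewrite psi_inflow by (cbn; lia). rewrite <- cis_plus.
      replace (xi * INR t + xi * (IZR (Z.of_nat 0) - INR t)) with 0 by (cbn; ring).
      rewrite cis_0, Nat.sub_0_r. unfold k. field. auto.
    - intros t. unfold p, x. rewrite psi_no_backflow by lia. rewrite Nat.sub_diag.
      cbn. ring.
    - intros t i Hi. unfold p. rewrite psi_step_L by lia. rewrite HS. unfold x.
      replace (M - 1 - i)%nat with (S (M - 1 - S i)) by lia.
      rewrite chi_step_L. ring.
    - intros t i Hi. unfold p. rewrite psi_step_R by lia. rewrite HS. unfold x.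
      replace (M - 1 - i)%nat with (S (M - 1 - S i)) by lia.
      rewrite (chi_step_R a b c d z (M - 1 - S i)) by auto. ring. }
  assert (Hlim : forall i, (i < M)%nat ->
    is_lim_seq (fun t => normsq (p t i)) (Cmod k ^ 2 * normsq (x i))).
  { intros i Hi. destruct (Hv i ltac:(lia)) as [HL HR]. unfold normsq.
    assert (Hmod : forall (y : C) t, Cmod y = Cmod (cis (xi * INR t) * y)).
    { intros y t. now rewrite Cmod_mult, Cmod_cis, Rmult_1_l. }
    assert (Hsq : forall (u : nat -> R) (l : R), is_lim_seq u l -> is_lim_seq (fun t => u t ^ 2) (l ^ 2)).
    { intros u l H. cbn. apply (is_lim_seq_mult' u (fun t => u t * 1)); auto.
      apply is_lim_seq_mult'; auto. apply is_lim_seq_const. }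
    replace (Cmod k ^ 2 * (Cmod (fst (x i)) ^ 2 + Cmod (snd (x i)) ^ 2)) with
      (Cmod (k * fst (x i)) ^ 2 + Cmod (k * snd (x i)) ^ 2) by (rewrite !Cmod_mult; ring).
    apply is_lim_seq_plus'; apply Hsq.
    - eapply null_Cmod_limit; [intros t; apply Hmod | exact HL].
    - eapply null_Cmod_limit; [intros t; apply Hmod | exact HR]. }
  assert (Hk : 0 < Cmod k ^ 2).
  { apply pow_lt. unfold k. rewrite Cmod_inv by auto. apply Rinv_0_lt_compat.
    now apply Cmod_gt_0. }
  assert (Hsum : 0 < sumM M (fun i => normsq (x i))).
  { destruct M as [|M']; [lia|]. rewrite sumM_Sl. apply Rplus_lt_le_0_compat.
    - unfold normsq, x. rewrite Nat.sub_0_r. apply Rplus_le_lt_0_compat; [apply pow2_ge_0|].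
      apply pow_lt. now apply Cmod_gt_0.
    - apply sumM_nonneg. intros i _. apply Rplus_le_le_0_compat; apply pow2_ge_0. }
  unfold mu.
  replace (stat_mu _ M j) with (Cmod k ^ 2 * normsq (x j) / (Cmod k ^ 2 * sumM M (fun i => normsq (x i)))).
  2:{ unfold stat_mu. rewrite <- (sumM_rev M (fun n => normsq (chi a b c d z n))).
      fold (x j). change (fun k0 : nat => normsq (chi a b c d z (M - 1 - k0))) with (fun i => normsq (x i)).
      change (normsq (chi a b c d z (M - 1 - j))) with (normsq (x j)). field.
      split; [lra | intros E; rewrite E in Hk; lra]. }
  rewrite <- sumM_scal.
  match goal with |- _ = ?r => enough (E : is_lim_seq
    (fun t => normsq (p t j) / sumM M (fun i => normsq (p t i))) r)
    by exact (f_equal real (is_lim_seq_unique _ _ E)) end.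
  apply is_lim_seq_div'.
  - apply Hlim. lia.
  - apply is_lim_seq_sumM. intros i Hi. now apply Hlim.
  - rewrite sumM_scal. apply Rgt_not_eq. now apply Rmult_lt_0_compat.
Qed.

(* Chebyshev polynomials of the second kind, shifted by one: [cheb t n] is U_{n-1}(t). *)
Fixpoint cheb (t : R) (n : nat) : R :=
  match n with
  | O => 0
  | S n' => match n' with O => 1 | S n'' => 2 * t * cheb t n' - cheb t n'' end
  end.

Lemma cheb_SS (t : R) (n : nat) : cheb t (S (S n)) = 2 * t * cheb t (S n) - cheb t n.
Proof. reflexivity. Qed.

(** For [al] = |a|^2, [be] = |b|^2 and [t] = cos(omega)/|a| this is [normsq] of [chi]; the limit
    laws are proved for arbitrary positive [al] and [be]. *)
Definition weight (al be t : R) (n : nat) : R := al + be * (cheb t n ^ 2 + cheb t (S n) ^ 2).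

(* Cayley-Hamilton for the transfer matrix, whose determinant a/d is the square of the unit
   complex number s and whose trace is 2 s cos(omega)/|a|. *)
Lemma chi_L_norm (a b c d : C) (xi : R) (n : nat) :
  unitary2 a b c d -> a <> 0%C -> d <> 0%C ->
  Cmod (fst (chi a b c d (cis xi) n)) ^ 2 =
  Cmod b ^ 2 * cheb (cos (omega a b c d xi) / Cmod a) n ^ 2.
Proof.
  intros HU Ha Hd. set (z := cis xi). set (t := cos (omega a b c d xi) / Cmod a).
  assert (Hz0 : z <> 0%C) by apply cis_neq0.
  (* With half the argument, [cis de] is a square root of the determinant and omega = de + xi. *)
  set (de := Carg (det2 a b c d) / 2).
  assert (HD : det2 a b c d = (cis de * cis de)%C).
  { rewrite <- cis_plus. unfold de.
    replace (Carg (det2 a b c d) / 2 + Carg (det2 a b c d) / 2) with (Carg (det2 a b c d)) by field.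
    apply cis_Carg. now apply Cmod_det. }
  assert (Hma := Ha). apply Cmod_gt_0 in Hma.
  assert (Hma' : RtoC (Cmod a) <> 0%C) by (intros E; apply RtoC_inj in E; lra).
  assert (Hde := cis_neq0 de).
  assert (Hac : Cconj a = (RtoC (Cmod a) * RtoC (Cmod a) / a)%C).
  { rewrite <- RtoC_mult. replace (Cmod a * Cmod a) with (Cmod a ^ 2) by ring.
    rewrite <- Cmult_conj_l. field. auto. }
  assert (Hdd : d = (cis de * cis de * (RtoC (Cmod a) * RtoC (Cmod a) / a))%C).
  { rewrite <- Hac, <- HD. now apply unitary_d. }
  (* The unit square root of a/d for which the trace of the transfer matrix is 2 s t with [t]
     real. *)
  set (s := (a / (cis de * RtoC (Cmod a)))%C).
  assert (Hs : Cmod s = 1).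
  { unfold s. rewrite Cmod_div, Cmod_mult, Cmod_cis, Cmod_R, Rabs_pos_eq by
      (try apply Cmult_neq_0; auto; lra). field. lra. }
  assert (Hs0 : s <> 0%C) by (apply Cmod_gt_0; rewrite Hs; lra).
  assert (Hdet : (s * s = a / d)%C).
  { rewrite Hdd. unfold s. field. auto. }
  assert (Hcos : (RtoC (2 * cos (omega a b c d xi)) = cis de * z + / (cis de * z))%C).
  { unfold omega, z. fold de. rewrite <- cis_plus.
    replace (/ cis (de + xi))%C with (cis (- (de + xi))).
    - unfold cis, RtoC, Cplus; cbn. rewrite cos_neg, sin_neg. f_equal; ring.
    - rewrite <- (Cmult_1_l (/ _)), <- (cis_opp (de + xi)). field. apply cis_neq0. }
  assert (Htr : (s * RtoC (2 * t) = (z * det2 a b c d + / z) / d)%C).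
  { unfold t. replace (2 * (cos (omega a b c d xi) / Cmod a)) with
      (2 * cos (omega a b c d xi) * / Cmod a) by (field; lra).
    rewrite RtoC_mult, Hcos, RtoC_inv, HD, Hdd. unfold s. { field; auto. } lra. }
  assert (Hrec : forall n, fst (chi a b c d z (S (S n))) =
    (s * RtoC (2 * t) * fst (chi a b c d z (S n)) - s * s * fst (chi a b c d z n))%C).
  { intros m. rewrite Htr, Hdet. unfold det2.
    rewrite (chi_step_L a b c d z (S m)). cbn [chi fst snd]. field. auto. }
  (* Formally the left component is s^(n-1) z b U_{n-1}(t); the extra factor [s] keeps the exponent
     a natural number at n = 0. *)
  assert (Hsol : forall n, (s * fst (chi a b c d z n) = s ^ n * (z * b) * RtoC (cheb t n))%C /\
    (s * fst (chi a b c d z (S n)) = s ^ S n * (z * b) * RtoC (cheb t (S n)))%C).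
  { induction n0 as [|m [IH1 IH2]].
    - split; cbn; ring.
    - split; auto. rewrite Hrec, cheb_SS.
      transitivity (s * RtoC (2 * t) * (s * fst (chi a b c d z (S m)))
        - s * s * (s * fst (chi a b c d z m)))%C; [ring|].
      rewrite IH1, IH2, RtoC_minus, (RtoC_mult (2 * t)). cbn [Cpow]. ring. }
  destruct (Hsol n) as [E _].
  assert (Hsn : Cmod (s ^ n) = 1).
  { induction n as [|m IH]; cbn; [apply Cmod_1|]. rewrite Cmod_mult, Hs, Rmult_1_l.
    apply IH. apply Hsol. }
  apply (f_equal Cmod) in E. rewrite !Cmod_mult, Hs, Hsn, Cmod_R in E.
  unfold z in E at 2. rewrite Cmod_cis, !Rmult_1_l in E. rewrite E, Rpow_mult_distr, pow2_abs.
  ring.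
Qed.

(* The stationary current |R|^2 at n minus |L|^2 at n+1 is independent of n. *)
Lemma chi_R_norm (a b c d : C) (xi : R) (n : nat) :
  unitary2 a b c d -> a <> 0%C -> d <> 0%C ->
  Cmod (snd (chi a b c d (cis xi) n)) ^ 2 =
  Cmod a ^ 2 + Cmod (fst (chi a b c d (cis xi) (S n))) ^ 2.
Proof.
  intros HU Ha Hd. set (z := cis xi).
  assert (Hz := Cmod_cis xi). fold z in Hz.
  assert (Hz0 : z <> 0%C) by apply cis_neq0.
  induction n as [|n IH].
  - cbn. replace (z * (a * 0 + b * 1))%C with (z * b)%C by ring.
    rewrite Cmod_mult, Hz, Cmod_1. assert (E := unitary_row a b c d HU Hd). lra.
  - assert (E := unitary_isometry a b c d HU
      (fst (chi a b c d z (S n))) (snd (chi a b c d z (S n)))).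
    assert (E1 := f_equal Cmod (chi_step_L a b c d z (S n))).
    assert (E2 := f_equal Cmod (chi_step_R a b c d z n Hz0 Hd)).
    rewrite Cmod_mult, Hz, Rmult_1_l in E1, E2.
    rewrite <- E1, <- E2 in E. lra.
Qed.

(** The right component of [chi] has squared modulus at least |a|^2 > 0, so [mu_chi] applies; the
    two norm formulas then add up to [weight]. *)
Lemma mu_weight (a b c d : C) (M : nat) (xi : R) (j : nat) :
  unitary2 a b c d -> a <> 0%C -> d <> 0%C -> (j < M)%nat ->
  mu a b c d M xi j =
  stat_mu (weight (Cmod a ^ 2) (Cmod b ^ 2) (cos (omega a b c d xi) / Cmod a)) M j.
Proof.
  intros HU Ha Hd Hj. rewrite mu_chi; auto.
  - assert (E : forall n, normsq (chi a b c d (cis xi) n) =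
      weight (Cmod a ^ 2) (Cmod b ^ 2) (cos (omega a b c d xi) / Cmod a) n).
    { intros n. unfold normsq, weight. rewrite chi_R_norm, !chi_L_norm by auto. ring. }
    unfold stat_mu. rewrite E. f_equal. apply sumM_ext. auto.
  - intros E. assert (H := chi_R_norm a b c d xi (M - 1) HU Ha Hd).
    rewrite E, Cmod_0 in H. apply Cmod_gt_0 in Ha.
    assert (E2 := pow2_ge_0 (Cmod (fst (chi a b c d (cis xi) (S (M - 1)))))).
    assert (0 < Cmod a ^ 2) by now apply pow_lt. lra.
Qed.

(** * Weak convergence from distribution functions *)

Definition lipschitz (K : R) (f : R -> R) : Prop :=
  forall x y, Rabs (f x - f y) <= K * Rabs (x - y).

Lemma lipschitz_continuous (K : R) (f : R -> R) (x : R) : lipschitz K f -> continuous f x.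
Proof.
  intros H. apply continuity_pt_filterlim. intros e He.
  assert (HK : 0 <= Rabs K) by apply Rabs_pos.
  exists (e / (Rabs K + 1)). split; [apply Rdiv_lt_0_compat; lra|].
  intros y [_ Hy]. cbn in *. unfold Rdist in *.
  apply Rle_lt_trans with (1 := H y x).
  apply Rle_lt_trans with (Rabs K * Rabs (y - x)).
  - apply Rmult_le_compat_r; [apply Rabs_pos | apply Rle_abs].
  - apply Rlt_div_r in Hy; [|lra]. assert (E := Rabs_pos (y - x)). nra.
Qed.

Lemma derive_bound_lipschitz (f df : R -> R) (K : R) :
  (forall x, is_derive f x (df x)) -> (forall x, Rabs (df x) <= K) -> lipschitz K f.
Proof.
  intros Hf HK x y.
  destruct (MVT_gen f y x df) as [c [_ Hc]].
  - auto.
  - intros u _. apply derivable_continuous_pt. exists (df u). now apply is_derive_Reals.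
  - rewrite Hc, Rabs_mult. apply Rmult_le_compat_r; [apply Rabs_pos | apply HK].
Qed.

(* The approximant is the moving average of f over a short interval. *)
Lemma lipschitz_approx (f : R -> R) (B eps : R) :
  (forall x, continuous f x) -> (forall x, Rabs (f x) <= B) -> 0 < eps ->
  exists K g, lipschitz K g /\ forall x, 0 <= x <= 1 -> Rabs (f x - g x) <= eps.
Proof.
  intros Hf HB He.
  assert (Hc : forall x, continuity_pt f x) by (intros x; apply continuity_pt_filterlim, Hf).
  (* The interval [0, 2] contains every window from x to x + h with x in [0, 1] and h <= 1. *)
  destruct (Heine f (fun x => 0 <= x <= 2) (compact_P3 0 2) (fun x _ => Hc x)
    (mkposreal eps He)) as [de Hde].
  set (h := Rmin (de / 2) 1).
  assert (Hh : 0 < h <= 1 /\ h < de).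
  { unfold h. assert (E := cond_pos de). unfold Rmin. destruct (Rle_dec (de / 2) 1); lra. }
  set (F := fun x => RInt f 0 x).
  assert (HF : forall x, is_derive F x (f x)).
  { intros x. apply (is_derive_RInt f F 0 x).
    - exists (mkposreal 1 Rlt_0_1). intros y _. apply (@RInt_correct R_CompleteNormedModule).
      apply (@ex_RInt_continuous R_CompleteNormedModule). auto.
    - auto. }
  assert (HL := derive_bound_lipschitz F f B HF HB).
  (* The primitive [F] is B-Lipschitz and occurs twice in the average, whence 2B/h. *)
  exists (2 * B / h), (fun x => (F (x + h) - F x) / h). split.
  - intros x y.
    replace ((F (x + h) - F x) / h - (F (y + h) - F y) / h) with
      (((F (x + h) - F (y + h)) - (F x - F y)) / h) by (field; lra).
    unfold Rdiv at 1. rewrite Rabs_mult, (Rabs_pos_eq (/ h)) by (apply Rlt_le, Rinv_0_lt_compat; lra).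
    replace (2 * B / h * Rabs (x - y)) with ((B * Rabs (x - y) + B * Rabs (x - y)) * / h) by (field; lra).
    apply Rmult_le_compat_r; [apply Rlt_le, Rinv_0_lt_compat; lra|].
    apply Rle_trans with (1 := Rabs_triang _ _). rewrite Rabs_Ropp.
    apply Rplus_le_compat; [|apply HL].
    replace (x - y) with ((x + h) - (y + h)) by ring. apply HL.
  - intros x Hx.
    destruct (MVT_gen F x (x + h) f) as [c [Hcx Hc2]].
    + auto.
    + intros u _. apply derivable_continuous_pt. exists (f u). now apply is_derive_Reals.
    + rewrite Rmin_left, Rmax_right in Hcx by lra.
      replace ((F (x + h) - F x) / h) with (f c) by (rewrite Hc2; field; lra).
      apply Rlt_le, (Hde x c); [lra | lra |]. rewrite <- Rabs_Ropp, Rabs_pos_eq; lra.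
Qed.

(** Both the expectation and [L] are contractions for the sup norm on [0, 1], where all atoms j/M
    lie. Replacing f by a Lipschitz g costs eps/4 on each side, and convergence for g costs another
    eps/4. *)
Lemma conv_of_lipschitz (p : nat -> nat -> R) (L : (R -> R) -> R) (f : R -> R) (B : R) :
  (forall M j, (j < M)%nat -> 0 <= p M j) ->
  (forall M, (0 < M)%nat -> sumM M (p M) = 1) ->
  (forall g h eps, (forall x, continuous g x) -> (forall x, continuous h x) ->
    (forall x, 0 <= x <= 1 -> Rabs (g x - h x) <= eps) -> Rabs (L g - L h) <= eps) ->
  (forall K g, lipschitz K g ->
    is_lim_seq (fun M => sumM M (fun j => p M j * g (INR j / INR M))) (L g)) ->
  (forall x, continuous f x) -> (forall x, Rabs (f x) <= B) ->
  is_lim_seq (fun M => sumM M (fun j => p M j * f (INR j / INR M))) (L f).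
Proof.
  intros Hp Hp1 HL Hlip Hf HB. apply is_lim_seq_spec. intros [eps He].
  destruct (lipschitz_approx f B (eps / 4) Hf HB ltac:(lra)) as (K & g & Hg & Hfg).
  assert (Hlim := Hlip K g Hg). apply is_lim_seq_spec in Hlim.
  destruct (Hlim (mkposreal (eps / 4) ltac:(lra))) as [N HN]. cbn in HN |- *.
  exists (S N). intros M HM. specialize (HN M ltac:(lia)).
  assert (E1 := HL f g (eps / 4) Hf (fun x => lipschitz_continuous K g x Hg) Hfg).
  assert (E2 : Rabs (sumM M (fun j => p M j * f (INR j / INR M)) -
    sumM M (fun j => p M j * g (INR j / INR M))) <= eps / 4).
  { assert (HM0 : 0 < INR M) by (apply lt_0_INR; lia).
    assert (Hj : forall j, (j < M)%nat ->
      Rabs (f (INR j / INR M) - g (INR j / INR M)) <= eps / 4).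
    { intros j Hj. apply Hfg. apply lt_INR in Hj. assert (E := pos_INR j). split.
      - apply Rdiv_le_0_compat; lra.
      - apply Rle_div_l; lra. }
    apply Rabs_le. split.
    - enough (sumM M (fun j => p M j * g (INR j / INR M)) <=
        sumM M (fun j => p M j * f (INR j / INR M) + eps / 4 * p M j)) as E.
      { rewrite sumM_plus, sumM_scal, Hp1 in E by lia. lra. }
      apply sumM_le. intros j Hjm. specialize (Hj j Hjm). apply Rabs_le_between in Hj.
      specialize (Hp M j Hjm). nra.
    - enough (sumM M (fun j => p M j * f (INR j / INR M)) <=
        sumM M (fun j => p M j * g (INR j / INR M) + eps / 4 * p M j)) as E.
      { rewrite sumM_plus, sumM_scal, Hp1 in E by lia. lra. }
      apply sumM_le. intros j Hjm. specialize (Hj j Hjm). apply Rabs_le_between in Hj.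
      specialize (Hp M j Hjm). nra. }
  apply Rabs_le_between in E1. apply Rabs_le_between in E2. apply Rabs_def2 in HN.
  apply Rabs_def1; lra.
Qed.

(** * Positivity and total mass of the stationary law *)

Lemma sumM_pos (w : nat -> R) (M : nat) :
  (forall n, 0 < w n) -> (0 < M)%nat -> 0 < sumM M w.
Proof.
  intros Hw HM. destruct M as [|M]; [lia|]. rewrite sumM_S.
  apply Rplus_le_lt_0_compat; auto. apply sumM_nonneg. intros k _. now apply Rlt_le.
Qed.

Lemma stat_mu_nonneg (w : nat -> R) (M j : nat) :
  (forall n, 0 < w n) -> (j < M)%nat -> 0 <= stat_mu w M j.
Proof.
  intros Hw Hj. apply Rdiv_le_0_compat; [now apply Rlt_le | apply sumM_pos; auto; lia].
Qed.

Lemma stat_mu_sum (w : nat -> R) (M : nat) :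
  (forall n, 0 < w n) -> (0 < M)%nat -> sumM M (stat_mu w M) = 1.
Proof.
  intros Hw HM. assert (H := sumM_pos w M Hw HM).
  transitivity (sumM M (fun j => / sumM M w * w (M - 1 - j)%nat)).
  - apply sumM_ext. intros k _. unfold stat_mu, Rdiv. ring.
  - rewrite sumM_scal, sumM_rev. field. lra.
Qed.

(** Weights are indexed from the right end, so [H] is the limiting distribution function of 1 - X.
    Reflection turns it into that of X, whose density is [g]. *)
Lemma is_derive_reflect (H g : R -> R) (x : R) :
  (forall y, is_derive H y (g (1 - y))) -> is_derive (fun x => 1 - H (1 - x)) x (g x).
Proof.
  intros HH. evar_last.
  - apply (is_derive_minus (fun _ => 1)); [apply is_derive_const|].
    apply (is_derive_comp H (fun x => 1 - x)); [apply HH|].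
    apply (is_derive_minus (fun _ => 1)); [apply is_derive_const | apply is_derive_id].
  - replace (1 - (1 - x)) with x by ring.
    unfold minus, plus, opp, zero, one, scal; cbn. unfold mult; cbn. ring.
Qed.

(* Abel summation against the error e_n between the two distribution functions, which vanishes
   at both ends. *)
Lemma cdf_error_bound (w : nat -> R) (H g f : R -> R) (K D : R) (M : nat) :
  (forall n, 0 < w n) -> (0 < M)%nat ->
  (forall x, 0 <= g x) -> (forall x, continuous g x) -> H 0 = 0 -> H 1 = 1 ->
  (forall y, is_derive H y (g (1 - y))) -> 0 <= K -> lipschitz K f ->
  (forall n, (n <= M)%nat -> Rabs (sumM n w / sumM M w - H (INR n / INR M)) <= D) ->
  Rabs (sumM M (fun j => stat_mu w M j * f (INR j / INR M)) - dens_law g f)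
  <= K * D + K / INR M.
Proof.
  intros Hw HM Hg Hgc H0 H1 HH HK Hf HD.
  assert (HS := sumM_pos w M Hw HM).
  assert (HM0 : 0 < INR M) by (apply lt_0_INR; lia).
  set (G := fun x => 1 - H (1 - x)).
  assert (HG : forall x, is_derive G x (g x)).
  { intros x. now apply is_derive_reflect. }
  assert (Hgf : forall x y, ex_RInt (fun u => g u * f u) x y).
  { intros x y. apply (@ex_RInt_continuous R_CompleteNormedModule). intros u _.
    apply (continuous_mult g f); auto. now apply lipschitz_continuous with K. }
  (* The mass of the first n sites minus G(n/M), written through the complementary sums from the
     right end. *)
  set (e := fun n => H (INR (M - n) / INR M) - sumM (M - n) w / sumM M w).
  assert (He : forall n, Rabs (e n) <= D).
  { intros n. unfold e. rewrite <- Rabs_Ropp, Ropp_minus_distr. apply HD. lia. }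
  (* The boundary term e_n f(n/M) is carried along. Each step then adds two errors: e_{n+1} times
     the increment of f, and the oscillation of f over one cell weighted by the mass of [g]
     there. *)
  assert (Key : forall n, (n <= M)%nat ->
    Rabs (sumM n (fun j => stat_mu w M j * f (INR j / INR M)) - e n * f (INR n / INR M)
      - RInt (fun u => g u * f u) 0 (INR n / INR M))
    <= INR n * (D * (K / INR M)) + K / INR M * G (INR n / INR M)).
  { induction n as [|n IH]; intros Hn.
    - unfold e. rewrite Nat.sub_0_r.
      replace (INR 0 / INR M) with 0 by (cbn; field; lra).
      replace (INR M / INR M) with 1 by (field; lra).
      replace (sumM M w / sumM M w) with 1 by (field; lra).
      rewrite RInt_point. unfold zero, G; cbn. rewrite (Rminus_0_r 1), H1.
      replace (0 - (1 - 1) * f 0 - 0) with 0 by ring. rewrite Rabs_R0. lra.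
    - specialize (IH ltac:(lia)). rewrite sumM_S.
      set (x := INR n / INR M) in *. set (y := INR (S n) / INR M).
      assert (Hxy : y - x = / INR M) by (unfold x, y; rewrite S_INR; field; lra).
      assert (HiM := Rinv_0_lt_compat _ HM0).
      rewrite <- (RInt_Chasles (fun u => g u * f u) 0 x y) by apply Hgf.
      change plus with Rplus.
      assert (Hp : stat_mu w M n = e (S n) - e n + (G y - G x)).
      { unfold stat_mu, e, G. replace (1 - x) with (INR (M - n) / INR M).
        2:{ unfold x. rewrite minus_INR by lia. field. lra. }
        replace (1 - y) with (INR (M - S n) / INR M).
        2:{ unfold y. rewrite minus_INR by lia. field. lra. }
        replace (M - n)%nat with (S (M - S n)) by lia. rewrite sumM_S.
        replace (M - 1 - n)%nat with (M - S n)%nat by lia. field. lra. }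
      assert (Hint : Rabs ((G y - G x) * f x - RInt (fun u => g u * f u) x y)
        <= K / INR M * (G y - G x)).
      { assert (IG : is_RInt g x y (G y - G x)).
        { apply (is_RInt_derive G g); auto. }
        apply (norm_RInt_le (fun u => f x * g u - g u * f u) (fun u => K / INR M * g u) x y).
        - lra.
        - intros u Hu. change norm with Rabs.
          replace (f x * g u - g u * f u) with (g u * (f x - f u)) by ring.
          rewrite Rabs_mult, (Rabs_pos_eq (g u)) by apply Hg.
          rewrite (Rmult_comm _ (g u)). apply Rmult_le_compat_l; [apply Hg|].
          apply Rle_trans with (1 := Hf x u). apply Rmult_le_compat_l; [assumption|].
          apply Rabs_le. lra.
        - rewrite Rmult_comm. apply (is_RInt_minus (fun u => f x * g u) (fun u => g u * f u)).
          + now apply (is_RInt_scal g).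
          + apply (@RInt_correct R_CompleteNormedModule). apply Hgf.
        - now apply (is_RInt_scal g). }
      assert (Hdf : Rabs (e (S n) * (f y - f x)) <= D * (K / INR M)).
      { rewrite Rabs_mult. apply Rmult_le_compat; try apply Rabs_pos; [apply He|].
        apply Rle_trans with (1 := Hf y x). rewrite Hxy, Rabs_pos_eq; [apply Rle_refl | lra]. }
      rewrite Hp, S_INR.
      apply Rabs_le_between in IH. apply Rabs_le_between in Hint. apply Rabs_le_between in Hdf.
      apply Rabs_le. nra. }
  (* At n = M the boundary term vanishes and the cell masses of [g] add up to 1. *)
  specialize (Key M (Nat.le_refl M)). unfold e, G in Key.
  rewrite Nat.sub_diag in Key.
  replace (INR M / INR M) with 1 in Key by (field; lra).
  replace (INR 0 / INR M) with 0 in Key by (cbn; field; lra).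
  replace (1 - 1) with 0 in Key by ring. rewrite H0 in Key.
  unfold dens_law. cbn [sumM] in Key.
  replace ((0 - sumM 0 w / sumM M w) * f 1) with 0 in Key by (cbn; field; lra).
  replace (INR M * (D * (K / INR M))) with (K * D) in Key by (field; lra).
  rewrite !Rminus_0_r, Rmult_1_r in Key. exact Key.
Qed.

Lemma monotone_unit_range (H g : R -> R) (y : R) :
  (forall x, 0 <= g x) -> H 0 = 0 -> H 1 = 1 ->
  (forall y, is_derive H y (g (1 - y))) -> 0 <= y <= 1 -> 0 <= H y <= 1.
Proof.
  intros Hg H0 H1 HH Hy.
  assert (Mon : forall u v, u <= v -> H u <= H v).
  { intros u v Huv.
    destruct (MVT_gen H u v (fun y => g (1 - y))) as [c [_ Hc]].
    - auto.
    - intros x _. apply derivable_continuous_pt. exists (g (1 - x)). now apply is_derive_Reals.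
    - specialize (Hg (1 - c)). nra. }
  assert (E1 := Mon 0 y). assert (E2 := Mon y 1). lra.
Qed.

(** The total mass of [g] on [0, 1] is H(1) - H(0) = 1, so averaging against it does not increase a
    uniform bound. *)
Lemma dens_law_contraction (g f h : R -> R) (H : R -> R) (eps : R) :
  (forall x, 0 <= g x) -> (forall x, continuous g x) -> H 0 = 0 -> H 1 = 1 ->
  (forall y, is_derive H y (g (1 - y))) ->
  (forall x, continuous f x) -> (forall x, continuous h x) ->
  (forall x, 0 <= x <= 1 -> Rabs (f x - h x) <= eps) ->
  Rabs (dens_law g f - dens_law g h) <= eps.
Proof.
  intros Hg Hgc H0 H1 HH Hf Hh Hfh.
  assert (I : forall k, (forall x, continuous k x) -> is_RInt (fun u => g u * k u) 0 1 (dens_law g k)).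
  { intros k Hk. apply (@RInt_correct R_CompleteNormedModule).
    apply (@ex_RInt_continuous R_CompleteNormedModule). intros u _.
    now apply (continuous_mult g k). }
  apply (norm_RInt_le (fun u => g u * f u - g u * h u) (fun u => eps * g u) 0 1).
  - lra.
  - intros u Hu. change norm with Rabs.
    replace (g u * f u - g u * h u) with (g u * (f u - h u)) by ring.
    rewrite Rabs_mult, (Rabs_pos_eq (g u)), Rmult_comm by apply Hg.
    apply Rmult_le_compat_r; auto.
  - apply (is_RInt_minus (fun u => g u * f u) (fun u => g u * h u)); auto.
  - assert (IG : is_RInt g 0 1 ((1 - H (1 - 1)) - (1 - H (1 - 0)))).
    { apply (is_RInt_derive (fun x => 1 - H (1 - x)) g); auto.
      intros x _. now apply is_derive_reflect. }
    rewrite (Rminus_0_r 1), (Rminus_diag 1), H0, H1 in IG.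
    apply (is_RInt_scal g 0 1 eps) in IG.
    evar_last; [exact IG|].
    unfold scal; cbn. unfold mult; cbn. ring.
Qed.

(* [kap M] rescales the unnormalised distribution function to order 1. *)
Lemma dens_conv (w : nat -> nat -> R) (H g f : R -> R) (kap A de : nat -> R) (m B : R) :
  (forall M n, 0 < w M n) ->
  (forall x, 0 <= g x) -> (forall x, continuous g x) -> H 0 = 0 -> H 1 = 1 ->
  (forall y, is_derive H y (g (1 - y))) ->
  0 < m -> (forall M, m <= A M) -> is_lim_seq de 0 ->
  (exists N, forall M, (N <= M)%nat -> forall n, (n <= M)%nat ->
    Rabs (kap M * sumM n (w M) - A M * H (INR n / INR M)) <= de M) ->
  (forall x, continuous f x) -> (forall x, Rabs (f x) <= B) ->
  is_lim_seq (fun M => sumM M (fun j => stat_mu (w M) M j * f (INR j / INR M))) (dens_law g f).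
Proof.
  intros Hw Hg Hgc H0 H1 HH Hm HA Hde [N HN].
  apply (conv_of_lipschitz (fun M => stat_mu (w M) M)).
  - intros M j. now apply stat_mu_nonneg.
  - intros M. now apply stat_mu_sum.
  - intros k h eps. now apply dens_law_contraction with H.
  - intros K k Hk.
    assert (HK : lipschitz (Rabs K) k).
    { intros x y. apply Rle_trans with (1 := Hk x y).
      apply Rmult_le_compat_r; [apply Rabs_pos | apply Rle_abs]. }
    clear Hk. revert HK. assert (HK0 := Rabs_pos K). revert HK0. generalize (Rabs K).
    clear K. intros K HK0 HK.
    (* The rescaled total mass is eventually at least m/2 and the numerator below is at most 2 de,
       so the quotient is at most (4/m) de. *)
    set (D := fun M => 4 / m * de M).
    assert (HD : is_lim_seq (fun M => K * D M + K / INR M) 0).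
    { replace (Finite 0) with (Finite (K * (4 / m * 0) + K * 0)) by (f_equal; ring).
      apply is_lim_seq_plus'.
      - apply (is_lim_seq_scal_l D K (4 / m * 0)). now apply (is_lim_seq_scal_l de (4 / m) 0).
      - apply (is_lim_seq_scal_l (fun M => / INR M) K 0).
        replace (Finite 0) with (Rbar_inv p_infty) by reflexivity.
        apply is_lim_seq_inv; [apply is_lim_seq_INR | discriminate]. }
    apply is_lim_seq_ext with (fun M =>
      (sumM M (fun j => stat_mu (w M) M j * k (INR j / INR M)) - dens_law g k) + dens_law g k).
    { intros M. ring. }
    replace (Finite (dens_law g k)) with (Finite (0 + dens_law g k)) by (f_equal; ring).
    apply is_lim_seq_plus'; [|apply is_lim_seq_const].
    apply is_lim_seq_abs_0.
    apply is_lim_seq_le_le_loc with (fun _ => 0) (fun M => K * D M + K / INR M);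
      [|apply is_lim_seq_const | assumption].
    apply is_lim_seq_spec in Hde.
    destruct (Hde (mkposreal (m / 2) ltac:(lra))) as [N2 HN2]. cbn in HN2.
    exists (S (N + N2)). intros M HM. split; [apply Rabs_pos|].
    specialize (HN M ltac:(lia)). specialize (HN2 M ltac:(lia)).
    rewrite Rminus_0_r in HN2. apply Rabs_def2 in HN2.
    apply cdf_error_bound with H; auto; [lia|].
    intros n Hn.
    assert (HM0 : 0 < INR M) by (apply lt_0_INR; lia).
    assert (E1 := HN M (Nat.le_refl M)). assert (E2 := HN n Hn).
    replace (INR M / INR M) with 1 in E1 by (field; lra). rewrite H1 in E1.
    assert (HS := sumM_pos (w M) M (Hw M) ltac:(lia)).
    set (y := INR n / INR M) in *.
    assert (Hy : 0 <= H y <= 1).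
    { apply monotone_unit_range with g; auto. apply le_INR in Hn. assert (E := pos_INR n).
      split; [apply Rdiv_le_0_compat; lra | apply Rle_div_l; lra]. }
    specialize (HA M). apply Rabs_le_between in E1. apply Rabs_le_between in E2.
    assert (HT : m / 2 <= kap M * sumM M (w M)) by lra.
    (* With kap S_n near A H(y) and kap S_M near A, the multiples of A cancel in the numerator. *)
    replace (sumM n (w M) / sumM M (w M) - H y) with
      ((kap M * sumM n (w M) - H y * (kap M * sumM M (w M))) / (kap M * sumM M (w M))).
    2:{ field. split; [lra|]. intros E. rewrite E in HT. lra. }
    unfold Rdiv at 1. rewrite Rabs_mult, (Rabs_pos_eq (/ _)) by (apply Rlt_le, Rinv_0_lt_compat; lra).
    apply Rle_div_l; [lra|].
    apply Rle_trans with (2 * de M).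
    + apply Rabs_le. nra.
    + unfold D. apply Rle_trans with (4 / m * de M * (m / 2)).
      * right. field. lra.
      * apply Rmult_le_compat_l; [|assumption]. apply Rmult_le_pos; [|lra].
        apply Rlt_le, Rdiv_lt_0_compat; lra.
Qed.

(* Geometric growth of the weights keeps the mean of [X_M] below 1/eta. *)
Lemma geometric_conv (w : nat -> R) (eta B : R) (f : R -> R) :
  (forall n, 0 < w n) -> 0 < eta -> (forall n, (1 + eta) * w n <= w (S n)) ->
  (forall x, continuous f x) -> (forall x, Rabs (f x) <= B) ->
  is_lim_seq (fun M => sumM M (fun j => stat_mu w M j * f (INR j / INR M))) (dirac0 f).
Proof.
  intros Hw Heta Hgrow.
  assert (E1 : forall M, eta * sumM M w <= w M).
  { induction M as [|M IH]; [cbn; specialize (Hw 0%nat); lra|].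
    rewrite sumM_S. specialize (Hgrow M). lra. }
  (* Adding a site moves the others one step further from the left end, which raises the
     unnormalised mean by the total weight; the previous bound absorbs this. *)
  assert (E2 : forall M, eta * sumM M (fun j => INR j * w (M - 1 - j)%nat) <= sumM M w).
  { induction M as [|M IH]; [cbn; lra|].
    rewrite sumM_Sl. change (INR 0) with 0.
    rewrite (sumM_ext M _ (fun j => INR j * w (M - 1 - j)%nat + w (M - 1 - j)%nat)).
    2:{ intros k Hk. rewrite S_INR. replace (S M - 1 - S k)%nat with (M - 1 - k)%nat by lia. ring. }
    rewrite sumM_plus, sumM_rev, sumM_S. specialize (E1 M). lra. }
  apply (conv_of_lipschitz (stat_mu w)).
  - intros M j. now apply stat_mu_nonneg.
  - intros M. now apply stat_mu_sum.
  - intros k h eps _ _ Hk. apply Hk. lra.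
  - intros K k Hk.
    apply is_lim_seq_ext with (fun M =>
      (sumM M (fun j => stat_mu w M j * k (INR j / INR M)) - k 0) + k 0).
    { intros M. ring. }
    unfold dirac0. replace (Finite (k 0)) with (Finite (0 + k 0)) by (f_equal; ring).
    apply is_lim_seq_plus'; [|apply is_lim_seq_const].
    apply is_lim_seq_abs_0.
    apply is_lim_seq_le_le_loc with (fun _ => 0) (fun M => Rabs K / eta * / INR M).
    + exists 1%nat. intros M HM. split; [apply Rabs_pos|].
      assert (HM0 : 0 < INR M) by (apply lt_0_INR; lia).
      assert (HS := sumM_pos w M Hw HM).
      (* The test function differs from its value at 0 by at most |K| j/M, whose mean is at most
         |K|/(eta M). *)
      assert (Hmean : sumM M (fun j => Rabs K / INR M * (INR j * stat_mu w M j))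
        <= Rabs K / eta * / INR M).
      { rewrite sumM_scal.
        rewrite (sumM_ext M _ (fun j => / sumM M w * (INR j * w (M - 1 - j)%nat)))
          by (intros; unfold stat_mu, Rdiv; ring).
        rewrite sumM_scal. unfold Rdiv. rewrite !Rmult_assoc.
        apply Rmult_le_compat_l; [apply Rabs_pos|]. rewrite (Rmult_comm (/ eta)).
        apply Rmult_le_compat_l; [now apply Rlt_le, Rinv_0_lt_compat|].
        specialize (E2 M). rewrite Rmult_comm. apply (Rle_div_l _ _ (sumM M w)); [assumption|].
        rewrite Rmult_comm. apply (Rle_div_r _ _ eta); [assumption|]. lra. }
      assert (H1 := stat_mu_sum w M Hw HM).
      assert (Hj : forall j, (j < M)%nat -> 0 <= stat_mu w M j /\
        Rabs (k (INR j / INR M) - k 0) <= Rabs K / INR M * INR j).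
      { intros j Hj. split; [now apply stat_mu_nonneg|].
        apply Rle_trans with (1 := Hk _ _). rewrite Rminus_0_r.
        assert (Ej := pos_INR j). rewrite (Rabs_pos_eq (INR j / INR M)) by (apply Rdiv_le_0_compat; lra).
        replace (Rabs K / INR M * INR j) with (Rabs K * (INR j / INR M)) by (field; lra).
        apply Rmult_le_compat_r; [apply Rdiv_le_0_compat; lra | apply Rle_abs]. }
      apply Rabs_le. split.
      * enough (sumM M (fun j => k 0 * stat_mu w M j) <=
          sumM M (fun j => stat_mu w M j * k (INR j / INR M) + Rabs K / INR M * (INR j * stat_mu w M j))) as E.
        { rewrite sumM_plus, (sumM_scal M (k 0)), H1 in E. lra. }
        apply sumM_le. intros j Hjm. destruct (Hj j Hjm) as [P Q]. apply Rabs_le_between in Q. nra.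
      * enough (sumM M (fun j => stat_mu w M j * k (INR j / INR M)) <=
          sumM M (fun j => k 0 * stat_mu w M j + Rabs K / INR M * (INR j * stat_mu w M j))) as E.
        { rewrite sumM_plus, (sumM_scal M (k 0)), H1 in E. lra. }
        apply sumM_le. intros j Hjm. destruct (Hj j Hjm) as [P Q]. apply Rabs_le_between in Q. nra.
    + apply is_lim_seq_const.
    + replace (Finite 0) with (Rbar_mult (Rabs K / eta) 0) by (cbn; f_equal; ring).
      apply is_lim_seq_scal_l. replace (Finite 0) with (Rbar_inv p_infty) by reflexivity.
      apply is_lim_seq_inv; [apply is_lim_seq_INR | discriminate].
Qed.

(** * Explicit weights *)

Lemma sin_lipschitz (x y : R) : Rabs (sin x - sin y) <= Rabs (x - y).
Proof.
  rewrite <- (Rmult_1_l (Rabs (x - y))).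
  apply (derive_bound_lipschitz sin cos 1).
  - intros u. apply is_derive_sin.
  - intros u. apply Rabs_le, COS_bound.
Qed.

Lemma sin_abs_le (x : R) : Rabs (sin x) <= Rabs x.
Proof. assert (E := sin_lipschitz x 0). rewrite sin_0, !Rminus_0_r in E. exact E. Qed.

(** The function sin u - u cos u vanishes at 0 and has derivative u sin u, nonnegative on
    [0, PI]. *)
Lemma sin_ge_x_cos (x : R) : 0 <= x <= PI -> x * cos x <= sin x.
Proof.
  intros Hx.
  destruct (MVT_gen (fun u => sin u - u * cos u) 0 x (fun u => u * sin u)) as [c [Hc E]].
  - intros u _. auto_derive; [auto | ring].
  - intros u _. apply derivable_continuous_pt. exists (u * sin u).
    apply is_derive_Reals. auto_derive; [auto | ring].
  - rewrite Rmin_left, Rmax_right in Hc by lra. rewrite sin_0 in E.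
    assert (S := sin_ge_0 c ltac:(lra) ltac:(lra)).
    assert (0 <= c * sin c) by (apply Rmult_le_pos; lra).
    assert (0 <= c * sin c * (x - 0)) by (apply Rmult_le_pos; lra). lra.
Qed.

Lemma cos_ge_parabola (x : R) : 1 - x ^ 2 / 2 <= cos x.
Proof.
  replace x with (2 * (x / 2)) at 2 by field. rewrite cos_2a_sin.
  assert (E := sin_abs_le (x / 2)). apply Rsqr_le_abs_1 in E. unfold Rsqr in E. nra.
Qed.

(** The factor x cot x multiplies the oscillating term of the partial sums. The lower bound 1 - x^2
    measures its approach to 1 at small angles; for x >= 1 it is trivial. *)
Lemma x_cot_bounds (x : R) :
  0 < x <= PI / 2 -> 0 < sin x /\ 0 <= x * cos x / sin x <= 1 /\ 1 - x ^ 2 <= x * cos x / sin x.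
Proof.
  intros Hx. assert (HPI := PI_RGT_0).
  assert (Hs : 0 < sin x) by (apply sin_gt_0; lra).
  assert (Hc : 0 <= cos x) by (apply cos_ge_0; lra).
  assert (H1 := sin_ge_x_cos x ltac:(lra)).
  assert (H2 := cos_ge_parabola x).
  assert (H3 := sin_lt_x x ltac:(lra)).
  repeat split; auto.
  - apply Rdiv_le_0_compat; [|assumption]. apply Rmult_le_pos; lra.
  - apply Rle_div_l; lra.
  - apply Rle_div_r; [assumption|].
    destruct (Rle_dec 1 x) as [h|h].
    + apply Rle_trans with 0; [|apply Rmult_le_pos; lra].
      assert (0 <= (x ^ 2 - 1) * sin x) by (apply Rmult_le_pos; nra). lra.
    + apply Rle_trans with ((1 - x ^ 2) * x); [apply Rmult_le_compat_l; nra | nra].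
Qed.

Lemma sin_taylor (u : R) : 0 <= u <= PI -> u - u ^ 3 / 6 <= sin u <= u - u ^ 3 / 6 + u ^ 5 / 120.
Proof.
  intros Hu. assert (E := sin_bound u 0 ltac:(lra) ltac:(lra)).
  unfold sin_approx, sin_term in E. simpl in E.
  lra.
Qed.

(** * Chebyshev weights: parity, partial sums and growth *)

Lemma weight_pos (al be t : R) (n : nat) : 0 < al -> 0 <= be -> 0 < weight al be t n.
Proof.
  intros Ha Hb. unfold weight.
  assert (E1 := pow2_ge_0 (cheb t n)). assert (E2 := pow2_ge_0 (cheb t (S n))). nra.
Qed.

Lemma cheb_opp_sqr (t : R) (n : nat) : cheb (- t) n ^ 2 = cheb t n ^ 2.
Proof.
  enough (H : forall n, cheb (- t) n = (-1) ^ S n * cheb t n /\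
    cheb (- t) (S n) = (-1) ^ S (S n) * cheb t (S n)).
  { destruct (H n) as [-> _]. rewrite Rpow_mult_distr, <- pow_mult, Nat.mul_comm, pow_1_even. ring. }
  clear n. induction n as [|n [IH1 IH2]].
  - cbn. split; ring.
  - split; auto. rewrite !cheb_SS, IH1, IH2. cbn. ring.
Qed.

Lemma weight_opp (al be t : R) (n : nat) : weight al be (- t) n = weight al be t n.
Proof. unfold weight. now rewrite !cheb_opp_sqr. Qed.

Lemma cheb_1 (n : nat) : cheb 1 n = INR n.
Proof.
  enough (H : forall n, cheb 1 n = INR n /\ cheb 1 (S n) = INR (S n)) by apply H.
  clear n. induction n as [|n [IH1 IH2]]; [cbn; lra|].
  split; auto. rewrite cheb_SS, IH1, IH2, !S_INR. ring.
Qed.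

(** The leading term 2 be n^3 / 3 is the origin of the limiting distribution function y^3. *)
Lemma weight_sum_1 (al be : R) (n : nat) :
  sumM n (weight al be 1) = al * INR n + be * (INR n * (2 * INR n ^ 2 + 1) / 3).
Proof.
  induction n as [|n IH]; [cbn; lra|].
  rewrite sumM_S, IH. unfold weight. rewrite !cheb_1, S_INR. field.
Qed.

Lemma cheb_cos (th : R) (n : nat) : cheb (cos th) n * sin th = sin (INR n * th).
Proof.
  enough (H : forall n, cheb (cos th) n * sin th = sin (INR n * th) /\
    cheb (cos th) (S n) * sin th = sin (INR (S n) * th)) by apply H.
  clear n. induction n as [|n [IH1 IH2]].
  - cbn. rewrite !Rmult_0_l, sin_0, !Rmult_1_l. lra.
  - split; auto. rewrite cheb_SS.
    replace ((2 * cos th * cheb (cos th) (S n) - cheb (cos th) n) * sin th) with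
      (2 * cos th * (cheb (cos th) (S n) * sin th) - cheb (cos th) n * sin th) by ring.
    rewrite IH1, IH2.
    replace (INR n * th) with (INR (S n) * th - th) by (rewrite S_INR; ring).
    replace (INR (S (S n)) * th) with (INR (S n) * th + th) by (rewrite (S_INR (S n)); ring).
    rewrite sin_plus, sin_minus. ring.
Qed.

(** The factor sin^2(th) clears the denominators of U_n = sin((n+1) th)/sin(th). With x = n th, the
    increment is sin^2 x + sin^2(x + th) = 1 - cos(th) cos(2x + th), and the last cosine is a
    difference of sines, so the sum telescopes. *)
Lemma weight_sum_cos (al be th : R) (n : nat) :
  sin th <> 0 ->
  sin th ^ 2 * sumM n (weight al be (cos th)) =
  al * sin th ^ 2 * INR n + be * (INR n - cos th * sin (2 * INR n * th) / (2 * sin th)).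
Proof.
  intros Hs. induction n as [|n IH].
  - cbn. rewrite !Rmult_0_r, Rmult_0_l, sin_0. field. auto.
  - rewrite sumM_S, Rmult_plus_distr_l, IH. unfold weight.
    replace (sin th ^ 2 * (al + be * (cheb (cos th) n ^ 2 + cheb (cos th) (S n) ^ 2))) with
      (al * sin th ^ 2 + be * ((cheb (cos th) n * sin th) ^ 2 + (cheb (cos th) (S n) * sin th) ^ 2))
      by ring.
    rewrite !cheb_cos, S_INR.
    set (x := INR n * th).
    replace ((INR n + 1) * th) with (x + th) by (unfold x; ring).
    replace (2 * INR n * th) with (2 * x) by (unfold x; ring).
    replace (2 * (INR n + 1) * th) with (2 * (x + th)) by (unfold x; ring).
    assert (P : sin (2 * (x + th)) = sin (2 * x) + 2 * cos (2 * x + th) * sin th).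
    { replace (2 * (x + th)) with ((2 * x + th) + th) by ring.
      replace (2 * x) with ((2 * x + th) - th) at 2 by ring.
      rewrite sin_plus, sin_minus. ring. }
    assert (Q : sin x ^ 2 + sin (x + th) ^ 2 = 1 - cos th * cos (2 * x + th)).
    { replace (2 * x + th) with (x + (x + th)) by ring.
      replace (cos th) with (cos ((x + th) - x)) by (f_equal; ring).
      rewrite cos_minus, (cos_plus x (x + th)).
      assert (E1 := sin2_cos2 x). assert (E2 := sin2_cos2 (x + th)). unfold Rsqr in *.
      set (y := x + th) in *. clearbody x y.
      transitivity (1 - ((cos x * cos x) * (cos y * cos y) - (sin x * sin x) * (sin y * sin y)));
        [|ring].
      replace (cos x * cos x) with (1 - sin x * sin x) by lra.
      replace (cos y * cos y) with (1 - sin y * sin y) by lra. ring. }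
    rewrite P, Q. field. auto.
Qed.

(** Monotonicity gives U_{n+1} = 2t U_n - U_{n-1} >= (2t - 1) U_n, with ratio 2t - 1 > 1; the sign
    bounds keep the induction going. *)
Lemma cheb_growth (t : R) (n : nat) :
  1 < t -> 0 <= cheb t n /\ 1 <= cheb t (S n) /\ (2 * t - 1) * cheb t n <= cheb t (S n).
Proof.
  intros Ht. induction n as [|n (IH1 & IH2 & IH3)]; [cbn; lra|].
  assert (cheb t n <= cheb t (S n)) by nra.
  assert (E : (2 * t - 1) * cheb t (S n) <= cheb t (S (S n))) by (rewrite cheb_SS; lra).
  repeat split; [lra | nra | exact E].
Qed.

Lemma weight_growth (al be t : R) :
  0 < al -> 0 < be -> 1 < t ->
  exists eta, 0 < eta /\ forall n, (1 + eta) * weight al be t n <= weight al be t (S n).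
Proof.
  intros Ha Hb Ht. set (r := 2 * t - 1).
  assert (Hr : 0 < r ^ 2 - 1) by (unfold r; nra).
  (* Only the part be v grows, by the factor r^2. Since v >= 1, it is at least the fraction be/(al +
     be) of the weight. *)
  exists (be * (r ^ 2 - 1) / (al + be)). split.
  { apply Rdiv_lt_0_compat; [now apply Rmult_lt_0_compat | lra]. }
  intros n. unfold weight.
  destruct (cheb_growth t n Ht) as (H1 & H2 & H3).
  destruct (cheb_growth t (S n) Ht) as (_ & _ & H4). fold r in H3, H4.
  assert (G : forall x y, 0 <= x -> r * x <= y -> r ^ 2 * x ^ 2 <= y ^ 2).
  { intros x y Hx Hxy. rewrite <- Rpow_mult_distr. apply pow_incr.
    split; [apply Rmult_le_pos; [unfold r; lra | assumption] | assumption]. }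
  apply G in H3; [|assumption]. apply G in H4; [|lra].
  set (v := cheb t n ^ 2 + cheb t (S n) ^ 2).
  assert (Hv : 1 <= v) by (unfold v; nra).
  set (v' := cheb t (S n) ^ 2 + cheb t (S (S n)) ^ 2).
  assert (Hv' : r ^ 2 * v <= v') by (unfold v, v'; lra).
  clearbody v v'.
  assert (E : be * (r ^ 2 - 1) / (al + be) * (al + be * v) <= be * (r ^ 2 - 1) * v).
  { replace (be * (r ^ 2 - 1) / (al + be) * (al + be * v)) with
      (be * (r ^ 2 - 1) * ((al + be * v) / (al + be))) by (field; lra).
    apply Rmult_le_compat_l; [apply Rmult_le_pos; lra|]. apply Rle_div_l; nra. }
  assert (be * (r ^ 2 * v) <= be * v') by (apply Rmult_le_compat_l; lra). lra.
Qed.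

(** Both branches of [theta] fold the angle into (0, PI/2], at the cost of the sign of the cosine;
    the weights are even in [t], so this sign is harmless. *)
Lemma theta_spec (a : C) (w : R) :
  0 < Cmod a -> B_in a w ->
  0 < theta a w <= PI / 2 /\
  (cos w / Cmod a = cos (theta a w) \/ cos w / Cmod a = - cos (theta a w)).
Proof.
  intros Ha Hw. unfold B_in in Hw. apply Rabs_def2 in Hw.
  assert (Hx : -1 < cos w / Cmod a < 1) by (split; [apply Rlt_div_r | apply Rlt_div_l]; lra).
  unfold theta. set (x := cos w / Cmod a) in *.
  assert (B := acos_bound_lt x Hx). assert (E := cos_acos x ltac:(lra)).
  assert (HPI := PI_RGT_0).
  destruct (Rlt_dec 0 x) as [h|h].
  - rewrite E. split; [|auto]. split; [lra|].
    apply Rnot_lt_le. intros Hlt. assert (N := cos_lt_0 (acos x) Hlt ltac:(lra)). lra.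
  - rewrite Rtrigo_facts.cos_pi_minus, E. split; [|right; ring]. split; [lra|].
    enough (PI / 2 <= acos x) by lra.
    apply Rnot_lt_le. intros Hlt. assert (N := cos_gt_0 (acos x) ltac:(lra) Hlt). lra.
Qed.

(** An exact formula in the variables y = n/M and t = M th, from which all three regimes inside are
    read off. *)
Lemma weight_sum_scaled (al be tau th : R) (M n : nat) :
  (tau = cos th \/ tau = - cos th) -> 0 < th <= PI / 2 -> (0 < M)%nat ->
  sin th ^ 2 / INR M * sumM n (weight al be tau) =
  al * sin th ^ 2 * (INR n / INR M) +
  be * (INR n / INR M - th * cos th / sin th *
    (sin (2 * (INR n / INR M) * (INR M * th)) / (2 * (INR M * th)))).
Proof.
  intros Htau Hth HM. destruct (x_cot_bounds th Hth) as (Hs & _ & _).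
  assert (HM0 : 0 < INR M) by (apply lt_0_INR; lia).
  replace (sumM n (weight al be tau)) with (sumM n (weight al be (cos th))).
  2:{ destruct Htau as [-> | ->]; [reflexivity|]. apply sumM_ext. intros k _.
      symmetry. apply weight_opp. }
  replace (2 * (INR n / INR M) * (INR M * th)) with (2 * INR n * th) by (field; lra).
  unfold Rdiv at 1. rewrite (Rmult_comm (sin th ^ 2)), Rmult_assoc, weight_sum_cos by lra.
  field. lra.
Qed.

(** * Null real sequences and estimates for sin(2yt)/(2t) *)

Lemma lim_inv_INR : is_lim_seq (fun M => / INR M) 0.
Proof.
  replace (Finite 0) with (Rbar_inv p_infty) by reflexivity.
  apply is_lim_seq_inv; [apply is_lim_seq_INR | discriminate].
Qed.

Lemma lim_sqr_0 (u : nat -> R) : is_lim_seq u 0 -> is_lim_seq (fun M => u M ^ 2) 0.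
Proof.
  intros H. replace (Finite 0) with (Finite (0 * 0)) by (f_equal; ring).
  apply is_lim_seq_ext with (fun M => u M * u M); [intros; ring|].
  now apply is_lim_seq_mult'.
Qed.

Lemma lim_lin_0 (k : R) (u : nat -> R) : is_lim_seq u 0 -> is_lim_seq (fun M => k * u M) 0.
Proof.
  intros H. replace (Finite 0) with (Rbar_mult k 0) by (cbn; f_equal; ring).
  now apply is_lim_seq_scal_l.
Qed.

Lemma lim_plus_0 (u v : nat -> R) :
  is_lim_seq u 0 -> is_lim_seq v 0 -> is_lim_seq (fun M => u M + v M) 0.
Proof.
  intros Hu Hv. replace (Finite 0) with (Finite (0 + 0)) by (f_equal; ring).
  now apply is_lim_seq_plus'.
Qed.

Lemma sinc_bound (y t : R) : 0 <= y -> 0 < t -> Rabs (sin (2 * y * t) / (2 * t)) <= y.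
Proof.
  intros Hy Ht. unfold Rdiv. rewrite Rabs_mult, (Rabs_pos_eq (/ _)) by
    (apply Rlt_le, Rinv_0_lt_compat; lra).
  apply Rle_div_l; [lra|].
  apply Rle_trans with (1 := sin_abs_le _). rewrite Rabs_pos_eq; [lra|].
  apply Rmult_le_pos; lra.
Qed.

Lemma sinc_diff_bound (y t ts : R) :
  0 <= y <= 1 -> 0 < t -> 0 < ts ->
  Rabs (sin (2 * y * ts) / (2 * ts) - sin (2 * y * t) / (2 * t)) <= 2 / ts * Rabs (t - ts).
Proof.
  intros Hy Ht Hts.
  set (q := sin (2 * y * t) / (2 * t)).
  assert (Hq : Rabs q <= 1) by (apply Rle_trans with y; [apply sinc_bound|]; lra).
  (* This separates the change of the numerator from that of the denominator; [q] is bounded by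
     1. *)
  replace (sin (2 * y * ts) / (2 * ts) - q) with
    (/ ts * ((sin (2 * y * ts) - sin (2 * y * t)) / 2 + (t - ts) * q)) by (unfold q; field; lra).
  replace (2 / ts * Rabs (t - ts)) with (/ ts * (Rabs (t - ts) + Rabs (t - ts) * 1)) by (field; lra).
  rewrite Rabs_mult, (Rabs_pos_eq (/ ts)) by (apply Rlt_le, Rinv_0_lt_compat; lra).
  apply Rmult_le_compat_l; [apply Rlt_le, Rinv_0_lt_compat; lra|].
  apply Rle_trans with (1 := Rabs_triang _ _). apply Rplus_le_compat.
  - unfold Rdiv. rewrite Rabs_mult, (Rabs_pos_eq (/ 2)) by lra.
    assert (E := sin_lipschitz (2 * y * ts) (2 * y * t)).
    replace (2 * y * ts - 2 * y * t) with (- (2 * y * (t - ts))) in E by ring.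
    rewrite Rabs_Ropp, Rabs_mult, (Rabs_pos_eq (2 * y)) in E by lra.
    assert (P := Rabs_pos (t - ts)). nra.
  - rewrite Rabs_mult. apply Rmult_le_compat_l; [apply Rabs_pos | assumption].
Qed.

(** Taylor expansion of the sine: the cubic term gives (2/3) y^3 t^2 and the quintic one bounds the
    rest. *)
Lemma sinc_cubic_bound (y t : R) :
  0 <= y <= 1 -> 0 < t <= 1 ->
  Rabs (y - sin (2 * y * t) / (2 * t) - 2 / 3 * y ^ 3 * t ^ 2) <= t ^ 4.
Proof.
  intros Hy Ht.
  assert (Hu : 0 <= 2 * y * t <= PI).
  { assert (P := PI2_1). assert (0 <= y * t <= 1) by nra. lra. }
  assert (E := sin_taylor _ Hu).
  replace (y - sin (2 * y * t) / (2 * t) - 2 / 3 * y ^ 3 * t ^ 2) with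
    (- ((sin (2 * y * t) - (2 * y * t - (2 * y * t) ^ 3 / 6)) / (2 * t))) by (field; lra).
  rewrite Rabs_Ropp, Rabs_pos_eq by (apply Rdiv_le_0_compat; lra).
  apply Rle_div_l; [lra|].
  apply Rle_trans with ((2 * y * t) ^ 5 / 120); [lra|].
  assert (y ^ 5 <= 1) by (rewrite <- (pow1 5); apply pow_incr; lra).
  assert (0 < t ^ 5) by (apply pow_lt; lra).
  replace ((2 * y * t) ^ 5 / 120) with (32 / 120 * t ^ 5 * y ^ 5) by field.
  replace (t ^ 4 * (2 * t)) with (2 * t ^ 5) by ring. nra.
Qed.

Lemma conv_in_dist_weight (a b c d : C) (xi : nat -> R) (L : (R -> R) -> R) :
  unitary2 a b c d -> a <> 0%C -> d <> 0%C ->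
  (forall f B, (forall x, continuous f x) -> (forall x, Rabs (f x) <= B) ->
    is_lim_seq (fun M => sumM M (fun j => stat_mu
      (weight (Cmod a ^ 2) (Cmod b ^ 2) (cos (omega a b c d (xi M)) / Cmod a)) M j
      * f (INR j / INR M))) (L f)) ->
  conv_in_dist a b c d xi L.
Proof.
  intros HU Ha Hd H f Hf [B HB]. eapply is_lim_seq_ext; [|exact (H f B Hf HB)].
  intros M. apply sumM_ext. intros j Hj. now rewrite mu_weight.
Qed.

Lemma unit_ratio (n M : nat) : (0 < M)%nat -> (n <= M)%nat -> 0 <= INR n / INR M <= 1.
Proof.
  intros HM Hn. assert (HM0 : 0 < INR M) by (apply lt_0_INR; lia).
  apply le_INR in Hn. assert (E := pos_INR n).
  split; [apply Rdiv_le_0_compat; lra | apply Rle_div_l; lra].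
Qed.

(** * The limit laws *)

Lemma conv_outside (al be tau B : R) (f : R -> R) :
  0 < al -> 0 < be -> 1 < Rabs tau ->
  (forall x, continuous f x) -> (forall x, Rabs (f x) <= B) ->
  is_lim_seq (fun M => sumM M (fun j =>
    stat_mu (weight al be tau) M j * f (INR j / INR M))) (dirac0 f).
Proof.
  intros Ha Hb Ht Hf HB. destruct (weight_growth al be (Rabs tau) Ha Hb Ht) as (eta & He & Hg).
  apply geometric_conv with eta B; auto.
  - intros n. apply weight_pos; lra.
  - intros n. destruct (Rcase_abs tau) as [h|h].
    + rewrite Rabs_left in Hg by assumption. specialize (Hg n). now rewrite !weight_opp in Hg.
    + rewrite Rabs_right in Hg by assumption. apply Hg.
Qed.

Lemma is_derive_cube (y : R) : is_derive (fun y => y ^ 3) y (3 * (1 - (1 - y)) ^ 2).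
Proof. auto_derive; [auto | ring]. Qed.

Lemma conv_boundary (al be tau B : R) (f : R -> R) :
  0 < al -> 0 < be -> Rabs tau = 1 ->
  (forall x, continuous f x) -> (forall x, Rabs (f x) <= B) ->
  is_lim_seq (fun M => sumM M (fun j =>
    stat_mu (weight al be tau) M j * f (INR j / INR M))) (dens_law (fun x => 3 * (1 - x) ^ 2) f).
Proof.
  intros Ha Hb Ht Hf HB.
  (* Dividing by M^3 leaves the amplitude 2 be/3; the terms linear in n give the error (al +
     be/3)/M^2. *)
  apply (dens_conv (fun _ => weight al be tau) (fun y => y ^ 3) _ f
    (fun M => / INR M ^ 3) (fun _ => 2 * be / 3) (fun M => (al + be / 3) * (/ INR M) ^ 2)
    (2 * be / 3) B); auto; try lra.
  - intros _ n. apply weight_pos; lra.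
  - intros x. assert (E := pow2_ge_0 (1 - x)). lra.
  - intros x. apply (ex_derive_continuous (fun x => 3 * (1 - x) ^ 2)). auto_derive. auto.
  - apply is_derive_cube.
  - intros _. lra.
  - apply lim_lin_0, lim_sqr_0, lim_inv_INR.
  - exists 1%nat. intros M HM n Hn.
    assert (HM0 : 0 < INR M) by (apply lt_0_INR; lia).
    assert (Hy := unit_ratio n M HM Hn).
    replace (sumM n (weight al be tau)) with (sumM n (weight al be 1)).
    2:{ apply sumM_ext. intros k _. unfold Rabs in Ht. destruct (Rcase_abs tau).
        - rewrite <- weight_opp. f_equal. lra.
        - now rewrite Ht. }
    rewrite weight_sum_1. set (y := INR n / INR M) in *.
    replace (INR n) with (y * INR M) by (unfold y; field; lra).
    replace (/ INR M ^ 3 * (al * (y * INR M) + be * (y * INR M * (2 * (y * INR M) ^ 2 + 1) / 3))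
      - 2 * be / 3 * y ^ 3) with ((al + be / 3) * (/ INR M) ^ 2 * y) by (field; lra).
    assert (0 <= (al + be / 3) * (/ INR M) ^ 2) by
      (apply Rmult_le_pos; [lra | apply pow2_ge_0]).
    rewrite Rabs_pos_eq by (apply Rmult_le_pos; lra). nra.
Qed.

(* [tau] stands for cos(omega)/|a|; its sign is lost because theta lies in (0, PI/2]. *)
Definition inner_angles (tau th : nat -> R) : Prop :=
  exists N, forall M, (N <= M)%nat ->
    0 < th M <= PI / 2 /\ (tau M = cos (th M) \/ tau M = - cos (th M)).

(** As t = M th tends to 0, the bracket y - q in the scaled sum is of order t^2. Division by t^2
    recovers the cubic law of the boundary case. *)
Lemma conv_inner_zero (al be B : R) (tau th : nat -> R) (f : R -> R) :
  0 < al -> 0 < be -> inner_angles tau th -> is_lim_seq (fun M => INR M * th M) 0 ->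
  (forall x, continuous f x) -> (forall x, Rabs (f x) <= B) ->
  is_lim_seq (fun M => sumM M (fun j =>
    stat_mu (weight al be (tau M)) M j * f (INR j / INR M))) (dens_law (fun x => 3 * (1 - x) ^ 2) f).
Proof.
  intros Ha Hb [N HN] Hlim Hf HB.
  apply (dens_conv (fun M => weight al be (tau M)) (fun y => y ^ 3) _ f
    (fun M => sin (th M) ^ 2 / INR M / (INR M * th M) ^ 2) (fun _ => 2 * be / 3)
    (fun M => (al + be) * (/ INR M) ^ 2 + be * (INR M * th M) ^ 2) (2 * be / 3) B); auto; try lra.
  - intros M n. apply weight_pos; lra.
  - intros x. assert (E := pow2_ge_0 (1 - x)). lra.
  - intros x. apply (ex_derive_continuous (fun x => 3 * (1 - x) ^ 2)). auto_derive. auto.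
  - apply is_derive_cube.
  - intros _. lra.
  - apply lim_plus_0; apply lim_lin_0, lim_sqr_0; [apply lim_inv_INR | assumption].
  - apply is_lim_seq_spec in Hlim. destruct (Hlim (mkposreal 1 Rlt_0_1)) as [N2 HN2].
    cbn in HN2. exists (S (N + N2)). intros M HM n Hn.
    destruct (HN M ltac:(lia)) as [Hth Htau]. specialize (HN2 M ltac:(lia)).
    rewrite Rminus_0_r in HN2. apply Rabs_def2 in HN2.
    assert (HM0 : 0 < INR M) by (apply lt_0_INR; lia).
    assert (Hy := unit_ratio n M ltac:(lia) Hn).
    destruct (x_cot_bounds _ Hth) as (Hs & Hk1 & Hk2).
    unfold Rdiv at 1. rewrite Rmult_assoc, (Rmult_comm (/ _)), <- Rmult_assoc.
    rewrite (weight_sum_scaled al be (tau M) (th M)) by (auto; lia).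
    assert (Ht : 0 < INR M * th M) by (apply Rmult_lt_0_compat; lra).
    assert (HiM : / INR M = th M / (INR M * th M)) by (field; lra).
    rewrite HiM.
    set (y := INR n / INR M) in *. set (t := INR M * th M) in *.
    set (k := th M * cos (th M) / sin (th M)) in *.
    assert (Hq := sinc_bound y t ltac:(lra) Ht).
    assert (Hc := sinc_cubic_bound y t Hy ltac:(lra)).
    set (q := sin (2 * y * t) / (2 * t)) in *.
    assert (Hsin : sin (th M) ^ 2 <= th M ^ 2).
    { apply pow_incr. split; [lra|]. apply Rlt_le, sin_lt_x. lra. }
    assert (Hs2 := pow2_ge_0 (sin (th M))).
    clearbody y t k q. set (s2 := sin (th M) ^ 2) in *. clearbody s2.
    assert (Ht2 : 0 < t ^ 2) by now apply pow_lt.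
    (* Three errors: the constant part of the weight, the Taylor remainder, and the deviation of th
       cot(th) from 1. After division by t^2 they are of orders 1/M^2, t^2 and 1/M^2. *)
    replace ((al * s2 * y + be * (y - k * q)) * / t ^ 2 - 2 * be / 3 * y ^ 3) with
      ((al * (s2 * y) + be * (y - q - 2 / 3 * y ^ 3 * t ^ 2) + be * ((1 - k) * q)) / t ^ 2)
      by (field; lra).
    replace ((al + be) * (th M / t) ^ 2 + be * t ^ 2) with
      ((al * th M ^ 2 + be * t ^ 4 + be * th M ^ 2) / t ^ 2) by (field; lra).
    unfold Rdiv at 1. rewrite Rabs_mult, (Rabs_pos_eq (/ _)) by now apply Rlt_le, Rinv_0_lt_compat.
    apply Rmult_le_compat_r; [now apply Rlt_le, Rinv_0_lt_compat|].
    apply Rle_trans with (1 := Rabs_triang _ _). apply Rplus_le_compat;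
      [apply Rle_trans with (1 := Rabs_triang _ _); apply Rplus_le_compat|];
      rewrite Rabs_mult, (Rabs_pos_eq) by lra; apply Rmult_le_compat_l; try lra.
    + rewrite Rabs_pos_eq by (apply Rmult_le_pos; lra). nra.
    + rewrite Rabs_mult, (Rabs_pos_eq (1 - k)) by lra.
      assert (P := Rabs_pos q). nra.
Qed.

(** The identity 1 - cos(2u) = 2 sin^2 u produces the squared sine and the factor 2 of [c_theta]. *)
Lemma is_derive_sin_cdf (ts y : R) :
  0 < ts -> 0 < 1 - sin (2 * ts) / (2 * ts) ->
  is_derive (fun y => (y - sin (2 * y * ts) / (2 * ts)) / (1 - sin (2 * ts) / (2 * ts))) y
    (c_theta ts * sin ((1 - (1 - y)) * ts) ^ 2).
Proof.
  unfold c_theta. set (K := 1 - sin (2 * ts) / (2 * ts)). intros Hts HK.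
  auto_derive; [lra|].
  replace (1 - (1 - y)) with y by ring.
  replace (2 * y * ts) with (2 * (y * ts)) by ring. rewrite cos_2a_sin. field. lra.
Qed.

Lemma conv_inner_finite (al be ts B : R) (tau th : nat -> R) (f : R -> R) :
  0 < al -> 0 < be -> 0 < ts -> inner_angles tau th -> is_lim_seq (fun M => INR M * th M) ts ->
  (forall x, continuous f x) -> (forall x, Rabs (f x) <= B) ->
  is_lim_seq (fun M => sumM M (fun j =>
    stat_mu (weight al be (tau M)) M j * f (INR j / INR M)))
    (dens_law (fun x => c_theta ts * (sin ((1 - x) * ts)) ^ 2) f).
Proof.
  intros Ha Hb Hts [N HN] Hlim Hf HB.
  set (K := 1 - sin (2 * ts) / (2 * ts)).
  assert (HK : 0 < K).
  { assert (E := sin_lt_x (2 * ts) ltac:(lra)). unfold K.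
    enough (sin (2 * ts) / (2 * ts) < 1) by lra. apply Rlt_div_l; lra. }
  (* The angle itself tends to 0, so sin^2(th) and 1 - th cot(th) vanish in the limit; it is written
     as (M th)/M to use the hypothesis. *)
  assert (Hth0 : is_lim_seq (fun M => INR M * th M * / INR M) 0).
  { replace (Finite 0) with (Finite (ts * 0)) by (f_equal; ring).
    apply is_lim_seq_mult'; [assumption | apply lim_inv_INR]. }
  assert (Hd0 : is_lim_seq (fun M => Rabs (INR M * th M - ts)) 0).
  { apply -> (is_lim_seq_abs_0 (fun M => INR M * th M - ts)).
    replace (Finite 0) with (Finite (ts - ts)) by (f_equal; ring).
    apply is_lim_seq_minus'; [assumption | apply is_lim_seq_const]. }
  apply (dens_conv (fun M => weight al be (tau M))
    (fun y => (y - sin (2 * y * ts) / (2 * ts)) / K) _ f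
    (fun M => sin (th M) ^ 2 / INR M) (fun _ => be * K)
    (fun M => (al + be) * (INR M * th M * / INR M) ^ 2 + be * (2 / ts) * Rabs (INR M * th M - ts))
    (be * K) B); auto; try lra.
  - intros M n. apply weight_pos; lra.
  - intros x. unfold c_theta. fold K. apply Rmult_le_pos; [|apply pow2_ge_0].
    apply Rmult_le_pos; [lra | now apply Rlt_le, Rinv_0_lt_compat].
  - intros x. apply (ex_derive_continuous (fun x => c_theta ts * (sin ((1 - x) * ts)) ^ 2)).
    auto_derive. auto.
  - rewrite Rmult_0_r, Rmult_0_l, sin_0. field. lra.
  - rewrite Rmult_1_r. fold K. field. lra.
  - intros y. apply is_derive_sin_cdf; unfold K in HK |- *; lra.
  - now apply Rmult_lt_0_compat.
  - intros _. lra.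
  - apply lim_plus_0; apply lim_lin_0; [now apply lim_sqr_0 | assumption].
  - exists (S N). intros M HM n Hn.
    destruct (HN M ltac:(lia)) as [Hth Htau].
    assert (HM0 : 0 < INR M) by (apply lt_0_INR; lia).
    assert (Hy := unit_ratio n M ltac:(lia) Hn).
    destruct (x_cot_bounds _ Hth) as (Hs & Hk1 & Hk2).
    rewrite (weight_sum_scaled al be (tau M) (th M)) by (auto; lia).
    replace (INR M * th M * / INR M) with (th M) by (field; lra).
    assert (Ht : 0 < INR M * th M) by (apply Rmult_lt_0_compat; lra).
    set (y := INR n / INR M) in *. set (t := INR M * th M) in *.
    set (k := th M * cos (th M) / sin (th M)) in *.
    assert (Hq := sinc_bound y t ltac:(lra) Ht).
    assert (Hc := sinc_diff_bound y t ts Hy Ht Hts).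
    set (q := sin (2 * y * t) / (2 * t)) in *. set (q' := sin (2 * y * ts) / (2 * ts)) in *.
    assert (Hsin : sin (th M) ^ 2 <= th M ^ 2).
    { apply pow_incr. split; [lra|]. apply Rlt_le, sin_lt_x. lra. }
    assert (Hs2 := pow2_ge_0 (sin (th M))).
    clearbody y t k q q'. set (s2 := sin (th M) ^ 2) in *. clearbody s2.
    replace (al * s2 * y + be * (y - k * q) - be * K * ((y - q') / K)) with
      (al * (s2 * y) + be * ((1 - k) * q) + be * (q' - q)) by (field; lra).
    replace ((al + be) * th M ^ 2 + be * (2 / ts) * Rabs (t - ts)) with
      (al * th M ^ 2 + be * th M ^ 2 + be * (2 / ts * Rabs (t - ts))) by ring.
    apply Rle_trans with (1 := Rabs_triang _ _). apply Rplus_le_compat;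
      [apply Rle_trans with (1 := Rabs_triang _ _); apply Rplus_le_compat|];
      rewrite Rabs_mult, (Rabs_pos_eq) by lra; apply Rmult_le_compat_l; try lra.
    + rewrite Rabs_pos_eq by (apply Rmult_le_pos; lra). nra.
    + rewrite Rabs_mult, (Rabs_pos_eq (1 - k)) by lra.
      assert (P := Rabs_pos q). nra.
Qed.

Lemma conv_inner_infty (al be B : R) (tau th : nat -> R) (f : R -> R) :
  0 < al -> 0 < be -> inner_angles tau th -> is_lim_seq (fun M => INR M * th M) p_infty ->
  (forall x, continuous f x) -> (forall x, Rabs (f x) <= B) ->
  is_lim_seq (fun M => sumM M (fun j =>
    stat_mu (weight al be (tau M)) M j * f (INR j / INR M))) (dens_law (fun _ => 1) f).
Proof.
  intros Ha Hb [N HN] Hlim Hf HB.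
  (* The angle need not converge, so the amplitude depends on M but stays at least [be]. The
     oscillating term is at most be/(2 M th). *)
  apply (dens_conv (fun M => weight al be (tau M)) (fun y => y) _ f
    (fun M => sin (th M) ^ 2 / INR M) (fun M => al * sin (th M) ^ 2 + be)
    (fun M => be / 2 * / (INR M * th M)) be B); auto; try lra.
  - intros M n. apply weight_pos; lra.
  - intros x. lra.
  - intros x. apply continuous_const.
  - intros y. apply (is_derive_id y).
  - intros M. assert (E := pow2_ge_0 (sin (th M))). nra.
  - apply lim_lin_0. replace (Finite 0) with (Rbar_inv p_infty) by reflexivity.
    apply is_lim_seq_inv; [assumption | discriminate].
  - exists (S N). intros M HM n Hn.
    destruct (HN M ltac:(lia)) as [Hth Htau].
    assert (HM0 : 0 < INR M) by (apply lt_0_INR; lia).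
    destruct (x_cot_bounds _ Hth) as (Hs & Hk1 & _).
    rewrite (weight_sum_scaled al be (tau M) (th M)) by (auto; lia).
    assert (Ht : 0 < INR M * th M) by (apply Rmult_lt_0_compat; lra).
    set (y := INR n / INR M) in *. set (t := INR M * th M) in *.
    set (k := th M * cos (th M) / sin (th M)) in *.
    assert (HS : Rabs (sin (2 * y * t)) <= 1) by apply Rabs_le, SIN_bound.
    set (q := sin (2 * y * t)) in *.
    replace (al * sin (th M) ^ 2 * y + be * (y - k * (q / (2 * t))) - (al * sin (th M) ^ 2 + be) * y)
      with (- (be / 2 * / t * (k * q))) by (field; lra).
    assert (0 < be / 2 * / t) by (apply Rmult_lt_0_compat; [lra | now apply Rinv_0_lt_compat]).
    rewrite Rabs_Ropp, !Rabs_mult, (Rabs_pos_eq k), <- Rabs_mult, (Rabs_pos_eq (be / 2 * / t)) by lra.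
    assert (P := Rabs_pos q). assert (k * Rabs q <= 1) by nra. nra.
Qed.

Theorem theorem3p1 (a b c d : C) :
  unitary2 a b c d ->
  (a * b * c * d <> 0)%C ->
  (* (i) omega fixed, in B_out: limit law is the point mass at 0 *)
  (forall xi0 : R, B_out a (omega a b c d xi0) ->
     conv_in_dist a b c d (fun _ => xi0) dirac0) /\
  (* (ii) omega fixed, on the boundary *)
  (forall xi0 : R, B_bd a (omega a b c d xi0) ->
     conv_in_dist a b c d (fun _ => xi0) (dens_law (fun x => 3 * (1 - x) ^ 2))) /\
  (* (ii) omega_M in B_in, M theta_M -> 0 *)
  (forall xi : nat -> R,
     (exists N, forall M, (N <= M)%nat -> B_in a (omega a b c d (xi M))) ->
     is_lim_seq (fun M => INR M * theta a (omega a b c d (xi M))) 0 ->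
     conv_in_dist a b c d xi (dens_law (fun x => 3 * (1 - x) ^ 2))) /\
  (* (iii) omega_M in B_in, M theta_M -> theta_* in (0, oo) *)
  (forall (xi : nat -> R) (ts : R), 0 < ts ->
     (exists N, forall M, (N <= M)%nat -> B_in a (omega a b c d (xi M))) ->
     is_lim_seq (fun M => INR M * theta a (omega a b c d (xi M))) ts ->
     conv_in_dist a b c d xi
       (dens_law (fun x => c_theta ts * (sin ((1 - x) * ts)) ^ 2))) /\
  (* (iv) omega_M in B_in, M theta_M -> oo: uniform law on [0,1] *)
  (forall xi : nat -> R,
     (exists N, forall M, (N <= M)%nat -> B_in a (omega a b c d (xi M))) ->
     is_lim_seq (fun M => INR M * theta a (omega a b c d (xi M))) p_infty ->
     conv_in_dist a b c d xi (dens_law (fun _ => 1))).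
Proof.
  intros HU Habcd.
  assert (Ha : a <> 0%C) by (intros ->; apply Habcd; ring).
  assert (Hb : b <> 0%C) by (intros ->; apply Habcd; ring).
  assert (Hd : d <> 0%C) by (intros ->; apply Habcd; ring).
  assert (Hma := proj1 (Cmod_gt_0 a) Ha). assert (Hmb := proj1 (Cmod_gt_0 b) Hb).
  assert (Ha2 : 0 < Cmod a ^ 2) by now apply pow_lt.
  assert (Hb2 : 0 < Cmod b ^ 2) by now apply pow_lt.
  assert (Habs : forall x, Rabs (x / Cmod a) = Rabs x / Cmod a).
  { intros x. unfold Rdiv. rewrite Rabs_mult, (Rabs_pos_eq (/ _)); [reflexivity|].
    now apply Rlt_le, Rinv_0_lt_compat. }
  assert (Hin : forall xi : nat -> R,
    (exists N, forall M, (N <= M)%nat -> B_in a (omega a b c d (xi M))) ->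
    inner_angles (fun M => cos (omega a b c d (xi M)) / Cmod a)
      (fun M => theta a (omega a b c d (xi M)))).
  { intros xi [N HN]. exists N. intros M HM. apply theta_spec; auto. }
  repeat split.
  - intros xi0 H. apply conv_in_dist_weight; auto. intros f B Hf HB.
    apply conv_outside with B; auto. rewrite Habs. unfold B_out in H. apply Rlt_div_r; lra.
  - intros xi0 H. apply conv_in_dist_weight; auto. intros f B Hf HB.
    apply conv_boundary with B; auto. rewrite Habs, H. field. lra.
  - intros xi H Hlim. apply conv_in_dist_weight; auto. intros f B Hf HB.
    now apply (conv_inner_zero _ _ B _ _ f Ha2 Hb2 (Hin xi H)).
  - intros xi ts Hts H Hlim. apply conv_in_dist_weight; auto. intros f B Hf HB.
    now apply (conv_inner_finite _ _ ts B _ _ f Ha2 Hb2 Hts (Hin xi H)).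
  - intros xi H Hlim. apply conv_in_dist_weight; auto. intros f B Hf HB.
    now apply (conv_inner_infty _ _ B _ _ f Ha2 Hb2 (Hin xi H)).
Qed.
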